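(* Suppose $\langle\cdot,\cdot\rangle$ is symmetric and that $n=\dim_k V\ge 2$. For a given $r\ge 1$, the maximal dimension of $Z(l,d,r;V)$, as $(l,d)$ ranges over integers with $1\le d\le n/2$ and $0\le l\le d$, is attained by and only by \begin{enumerate} \item $\dim Z(0,1,1;V)=\dim Z(1,1,1;V)=\dim Z(2,2,1;V)=13$ if $n=4$ and $r=1$; \item $\dim Z(2,2,r;V)=12r+1$ if $n=4$ and $r\ge 2$; \item $\dim Z(0,1,1;V)=\dim Z(1,1,1;V)=n^2-n+1$ if $n\ne 4$ and $r=1$; \item $\dim Z(1,1,r;V)=n-2+r(n^2-2n+3)$ if $n\ne 4$ and $r\ge 2$. \end{enumerate}
   Context: $k$ is an algebraically closed field of characteristic different from $2$; $n,r$ are positive integers; $V=k^n$ is equipped with a nondegenerate bilinear form $\langle\cdot,\cdot\rangle$ (here symmetric). $\rho$ is the adjoint involution on $\mathrm{End}_k(V)$, determined by $\langle\rho(A)v,w\rangle=\langle v,Aw\rangle$ for all $v,w\in V$. For a subspace $W\subseteq V$, $W^\perp=\{x\in V\mid \langle w,x\rangle=0\ \forall w\in W\}$ and the isotropy rank of $W$ is $\dim_k(W\cap W^\perp)$. For $A_\bullet=(A_1,\dots,A_r)\in\mathrm{End}_k(V)^r$, $W$ is $\rho$-invariant under $A_\bullet$ if $A_iW\subseteq W$ and $\rho(A_i)W\subseteq W$ for all $i$. $Z(\ge l,d,r;V)$ is the set of $A_\bullet\in\mathrm{End}_k(V)^r$ having some $\rho$-invariant subspace of dimension $d$ and isotropy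 rank at least $l$; it is Zariski closed. $Z(l,d,r;V)=Z(\ge l,d,r;V)\setminus Z(\ge l+1,d,r;V)$. The dimension of a (possibly reducible) variety is the maximum of the dimensions of its irreducible components. *)

(* Defs.v *)
From HB Require Import structures.
From mathcomp Require Import all_boot all_order all_algebra.
From mathcomp Require Import sesquilinear.
From mathcomp Require Export mpoly.

Set Implicit Arguments.
Unset Strict Implicit.
Unset Printing Implicit Defensive.

Import GRing.Theory.
Local Open Scope ring_scope.

Section Zariski.
Variables (k : closedFieldType) (N : nat).
Implicit Types X Y C : 'rV[k]_N -> Prop.

Definition subset_of X Y := forall x, X x -> Y x.

Definition zclosed C :=
  exists I : {mpoly k[N]} -> Prop,
    forall x, C x <-> forall p, I p -> p.@[fun i => x ord0 i] = 0.

Definition zclosed_in X Y :=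
  exists2 C, zclosed C & forall x, Y x <-> X x /\ C x.

(* Irreducibility for the topology induced on Y. *)
Definition irreducible_set Y :=
  (exists x, Y x) /\
  forall C1 C2, zclosed_in Y C1 -> zclosed_in Y C2 ->
    (forall x, Y x -> C1 x \/ C2 x) -> subset_of Y C1 \/ subset_of Y C2.

Definition irreducible_component X Y :=
  [/\ zclosed_in X Y, irreducible_set Y &
      forall Y', zclosed_in X Y' -> irreducible_set Y' ->
        subset_of Y Y' -> subset_of Y' Y].

(* F 0 < F 1 < ... < F m, all irreducible and closed in Y: this says that the
   Krull dimension of Y is at least m. *)
Definition has_irreducible_chain Y (m : nat) :=
  exists F : nat -> 'rV[k]_N -> Prop,
    (forall i, (i <= m)%N -> zclosed_in Y (F i) /\ irreducible_set (F i)) /\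
    (forall i, (i < m)%N ->
       subset_of (F i) (F i.+1) /\ ~ subset_of (F i.+1) (F i)).

(* Some irreducible component of X has Krull dimension at least m; this fails
   for every m when X is empty. *)
Definition dim_ge X (m : nat) :=
  exists2 Y, irreducible_component X Y & has_irreducible_chain Y m.

Definition is_dim X (m : nat) := dim_ge X m /\ ~ dim_ge X m.+1.

End Zariski.

Section IsotropyRank.
Variables (k : closedFieldType) (n r : nat).
Variable form : {symmetric 'cV[k]_n}.

(* An endomorphism of k^n is a matrix acting on column vectors by A *m v. *)
Definition is_adjoint (rho : 'M[k]_n -> 'M[k]_n) :=
  forall A v w, form (rho A *m v) w = form v (A *m w).

Definition stable (A : 'M[k]_n) (W : {vspace 'cV[k]_n}) :=
  forall w, w \in W -> A *m w \in W.

Definition rho_invariant (rho : 'M[k]_n -> 'M[k]_n) (A : 'I_r -> 'M[k]_n)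
    (W : {vspace 'cV[k]_n}) :=
  forall i, stable (A i) W /\ stable (rho (A i)) W.

Definition isotropy_rank (W : {vspace 'cV[k]_n}) : nat :=
  \dim (W :&: orthov form W).

Definition Zge (rho : 'M[k]_n -> 'M[k]_n) (l d : nat) (A : 'I_r -> 'M[k]_n) :=
  exists W : {vspace 'cV[k]_n},
    [/\ rho_invariant rho A W, \dim W = d & (l <= isotropy_rank W)%N].

Definition Zeq (rho : 'M[k]_n -> 'M[k]_n) (l d : nat) (A : 'I_r -> 'M[k]_n) :=
  Zge rho l d A /\ ~ Zge rho l.+1 d A.

(* The r-tuple of matrices with coordinates x, under the identification of
   End(k^n)^r with affine space of dimension r * n^2. *)
Definition tuple_of_coords (x : 'rV[k]_(r * (n * n))) : 'I_r -> 'M[k]_n :=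
  fun i => vec_mx (row i (vec_mx x)).

Definition Zvar (rho : 'M[k]_n -> 'M[k]_n) (l d : nat) :
    'rV[k]_(r * (n * n)) -> Prop :=
  fun x => Zeq rho l d (tuple_of_coords x).

End IsotropyRank.

(* "Has dimension at most M" is written as ~ dim_ge _ M.+1, so that it also
   covers an empty Z l d; such a Z l d never satisfies is_dim. The list S is
   meant to be nonempty and inside the range of (l, d). *)
Definition max_dim_exactly_at (k : closedFieldType) (n N : nat)
    (Z : nat -> nat -> 'rV[k]_N -> Prop) (S : seq (nat * nat)) (M : nat) :=
  forall l d, (1 <= d)%N -> (2 * d <= n)%N -> (l <= d)%N ->
    ~ dim_ge (Z l d) M.+1 /\ (is_dim (Z l d) M <-> (l, d) \in S).

(* Main.v *)
Require Import Defs.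
From HB Require Import structures.
From mathcomp Require Import all_boot all_order all_algebra perm.
From mathcomp Require Import sesquilinear zify ring.
From Stdlib Require Import Classical.

Set Implicit Arguments.
Unset Strict Implicit.
Unset Printing Implicit Defensive.

Import GRing.Theory.
Local Open Scope ring_scope.

(** Let W have dimension d and isotropy rank l, and put e = d - l and
    f = n - d - l. A tuple is rho-invariant on W exactly when it preserves W
    and its orthogonal W'. It then preserves the radical L of W, of dimension
    l, the orthogonal of L, and on the quotient of the latter by L, a
    nondegenerate space of dimension e + f, the image of W and the orthogonal
    of this image. The isotropic subspaces L of dimension l depend on
    l (e + f) + l (l - 1) / 2 parameters, the image of W on e f, and the
    matrices with this invariance form a vector space of dimension
    3 l^2 + 2 l (e + f) + e^2 + f^2. This gives the number stratum_dim.
    It bounds the dimension of every Z(l, d), and is equal to it in the cases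
    of the statement; comparing these numbers over all (l, d) is elementary.

    Upper bound. Each step of a chain of irreducible closed sets supplies a
    polynomial that vanishes on one set but not on the next, and the
    power products of these polynomials are linearly independent
    (chain_indep). On a set covered by finitely many polynomial images of
    k^M, counting monomials bounds the length of a chain by M
    (chain_le_params). The count of parameters above is made into such a
    cover as follows. Around each hyperbolic basis, unipotent isometries
    parametrize the isotropic subspaces of a big cell by polynomials, and
    finitely many of these cells suffice (finite_cells). In a basis
    adapted to L the matrices are block triangular (adapted_shape), and their
    middle blocks stabilize a nondegenerate subspace, which is a graph up to
    a permutation of an orthonormal basis (stable_graph_shape). The result is
    cover_by_chart.

    Lower bound. A chart whose coordinates can be recovered by polynomials
    one after the other, each under the condition that certain others vanish,
    yields a chain as long as the number of its coordinates
    (chain_of_chart). For Z(l, l), which gives Z(1, 1) and Z(2, 2), the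
    coordinates of the chart above are recovered from the upper right block
    of the matrices downwards, because the unipotent isometries are lower
    triangular (isotropic_chain). For Z(0, 1) with a single matrix, the chart
    is parametrized by a common eigenvector (1, u) of the matrix and of its
    transpose, its eigenvalue, and a square block of size n - 1. Such a
    matrix A has no invariant isotropic line with invariant orthogonal if the
    eigenvalues of the self-adjoint matrix A + rho A are distinct, which is
    the non-vanishing of a Hankel determinant of traces
    (nondegenerate_chain). *)

(** * Polynomial functions of bounded degree *)

Section PolyFun.
Variables (k : fieldType) (I : finType).
Implicit Types (f g : (I -> k) -> k) (t : I -> k).

(** Parameters are indexed by an arbitrary finite type, so that a chart can
    name its coordinates by sums and products of types; only the evaluation
    uses the enumeration of I. *)
Definition polyfun_le d f := exists2 p : {mpoly k[#|I|]},
  (msize p <= d.+1)%N & forall t, f t = p.@[fun j => t (enum_val j)].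

Definition polyfun f := exists d, polyfun_le d f.

Lemma polyfun_le_ext d f g : f =1 g -> polyfun_le d f -> polyfun_le d g.
Proof. by move=> fg [p sp fp]; exists p => // t; rewrite -fg. Qed.

Lemma polyfun_le_weaken d d' f : (d <= d')%N -> polyfun_le d f -> polyfun_le d' f.
Proof. by move=> dd' [p sp fp]; exists p => //; apply: leq_trans sp _. Qed.

Lemma polyfun_le_const c : polyfun_le 0 (fun _ => c).
Proof. by exists c%:MP => [|t]; [rewrite msizeC leq_b1 | rewrite mevalC]. Qed.

Lemma polyfun_le_var i : polyfun_le 1 (fun t => t i).
Proof.
exists 'X_(enum_rank i) => [|t]; first by rewrite msizeX mdeg1.
by rewrite mevalXU enum_rankK.
Qed.

Lemma polyfun_leD d f g : polyfun_le d f -> polyfun_le d g -> polyfun_le d (fun t => f t + g t).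
Proof.
move=> [p sp fp] [q sq gq]; exists (p + q) => [|t]; last by rewrite mevalD fp gq.
by apply: leq_trans (msizeD_le _ _) _; rewrite geq_max sp sq.
Qed.

Lemma polyfun_leM d d' f g : polyfun_le d f -> polyfun_le d' g -> polyfun_le (d + d') (fun t =>
    f t * g t).
Proof.
move=> [p sp fp] [q sq gq]; exists (p * q) => [|t]; last by rewrite mevalM fp gq.
have [->|p0] := eqVneq p 0; first by rewrite mul0r msize0.
have [->|q0] := eqVneq q 0; first by rewrite mulr0 msize0.
rewrite msizeM // -subn1 leq_subLR add1n.
by apply: leq_trans (leq_add sp sq) _; rewrite addSn addnS.
Qed.

Lemma polyfun_leX d f e : polyfun_le d f -> polyfun_le (e * d) (fun t => f t ^+ e).
Proof.
move=> pf; elim: e => [|e IH].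
  by apply: polyfun_le_ext (polyfun_le_const 1) => t; rewrite expr0.
by rewrite mulSn; apply: polyfun_le_ext (polyfun_leM pf IH) => t; rewrite exprS.
Qed.

Lemma polyfun_ext f g : f =1 g -> polyfun f -> polyfun g.
Proof. by move=> fg [d pf]; exists d; apply: polyfun_le_ext pf. Qed.

Lemma polyfun_const c : polyfun (fun _ => c).
Proof. by exists 0%N; apply: polyfun_le_const. Qed.

Lemma polyfun_var i : polyfun (fun t => t i).
Proof. by exists 1%N; apply: polyfun_le_var. Qed.

Lemma polyfunD f g : polyfun f -> polyfun g -> polyfun (fun t => f t + g t).
Proof.
move=> [d pf] [d' pg]; exists (maxn d d'); apply: polyfun_leD.
  by apply: polyfun_le_weaken pf; apply: leq_maxl.
by apply: polyfun_le_weaken pg; apply: leq_maxr.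
Qed.

Lemma polyfunM f g : polyfun f -> polyfun g -> polyfun (fun t => f t * g t).
Proof. by move=> [d pf] [d' pg]; exists (d + d')%N; apply: polyfun_leM. Qed.

Lemma polyfunN f : polyfun f -> polyfun (fun t => - f t).
Proof.
by move/(polyfunM (polyfun_const (-1))); apply: polyfun_ext => t; rewrite mulN1r.
Qed.

Lemma polyfunX f e : polyfun f -> polyfun (fun t => f t ^+ e).
Proof. by move=> [d pf]; exists (e * d)%N; apply: polyfun_leX. Qed.

Lemma polyfun_sum (J : Type) (r : seq J) (P : pred J) (F : J -> (I -> k) -> k) :
  (forall j, polyfun (F j)) -> polyfun (fun t => \sum_(j <- r | P j) F j t).
Proof.
move=> pF; elim: r => [|j r IH].
  by apply: polyfun_ext (polyfun_const 0) => t; rewrite big_nil.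
case Pj: (P j).
  by apply: polyfun_ext (polyfunD (pF j) IH) => t; rewrite big_cons Pj.
by apply: polyfun_ext IH => t; rewrite big_cons Pj.
Qed.

Lemma polyfun_prod (J : Type) (r : seq J) (P : pred J) (F : J -> (I -> k) -> k) :
  (forall j, polyfun (F j)) -> polyfun (fun t => \prod_(j <- r | P j) F j t).
Proof.
move=> pF; elim: r => [|j r IH].
  by apply: polyfun_ext (polyfun_const 1) => t; rewrite big_nil.
case Pj: (P j).
  by apply: polyfun_ext (polyfunM (pF j) IH) => t; rewrite big_cons Pj.
by apply: polyfun_ext IH => t; rewrite big_cons Pj.
Qed.

Lemma polyfun_meval N (phi : 'I_N -> (I -> k) -> k) (p : {mpoly k[N]}) :
  (forall j, polyfun (phi j)) -> polyfun (fun t => p.@[fun j => phi j t]).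
Proof.
move=> pphi; apply: polyfun_ext (fun t => esym (mevalE _ _)) _.
apply: polyfun_sum => m; apply: polyfunM; first exact: polyfun_const.
by apply: polyfun_prod => j; apply: polyfunX.
Qed.

(** Restriction to a line turns questions about non-vanishing of polynomial
    functions into questions about polynomials in one variable. *)
Lemma polyfun_line f t0 t1 : polyfun f ->
  exists q : {poly k}, forall s, f (fun i => t0 i + s * (t1 i - t0 i)) = q.[s].
Proof.
move=> [d [p _ fp]].
pose lin i := (t0 i)%:P + 'X * (t1 i - t0 i)%:P.
exists (\sum_(m <- msupp p) (p@_m)%:P * \prod_i (lin (enum_val i)) ^+ m i).
move=> s; rewrite fp mevalE horner_sum; apply: eq_bigr => m _.
rewrite hornerM hornerC horner_prod; congr (_ * _); apply: eq_bigr => i _.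
by rewrite horner_exp hornerD hornerM !hornerC hornerX.
Qed.

Definition monomial_fun (m : 'X_{1..#|I|}) (t : I -> k) := \prod_i t (enum_val i) ^+ m i.

Lemma polyfun_le_span d f : polyfun_le d f ->
  exists a : 'X_{1..#|I| < d.+1} -> k, forall t, f t = \sum_m a m * monomial_fun m t.
Proof.
move=> [p sp fp]; exists (fun m => p@_m) => t.
rewrite fp {1}(mpolywE sp) raddf_sum /=; apply: eq_bigr => m _.
by rewrite mevalZ mevalX.
Qed.

Lemma card_bmultinom (n d : nat) : (#|{: 'X_{1..n < d.+1}}| <= d.+1 ^ n)%N.
Proof.
pose h (m : 'X_{1..n < d.+1}) : {ffun 'I_n -> 'I_d.+1} := [ffun i => inord (m i)].
have hinj : injective h.
  move=> m1 m2 /ffunP eqh; apply/val_inj/mnmP => i.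
  have := congr1 (@nat_of_ord _) (eqh i); rewrite !ffunE !inordK //.
    apply: leq_ltn_trans (bmdeg m2); rewrite mdegE (bigD1 i) //= leq_addr //.
  apply: leq_ltn_trans (bmdeg m1); rewrite mdegE (bigD1 i) //= leq_addr //.
by have := leq_card h hinj; rewrite card_ffun !card_ord.
Qed.

End PolyFun.

Section Counting.
Variables (k : fieldType) (T : Type).

Definition lin_indep_on (J : finType) (X : T -> Prop) (g : J -> T -> k) :=
  forall c : J -> k, (forall x, X x -> \sum_j c j * g j x = 0) ->
  forall j, c j = 0.

(** Along each chart the functions lie in the span of (D + 1)^#|I| monomials.
    If there were more functions than pairs (chart, monomial), one linear
    relation would hold along all charts at once, hence on X. *)
Lemma chart_count (C I J : finType) (Phi : C -> (I -> k) -> T) (X : T -> Prop)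
    (g : J -> T -> k) (D : nat) :
  (forall x, X x -> exists c t, x = Phi c t) ->
  (forall j c, polyfun_le D (fun t => g j (Phi c t))) ->
  lin_indep_on X g -> (#|J| <= #|C| * D.+1 ^ #|I|)%N.
Proof.
move=> cover pg indep.
have [a aE] : exists a : J * C -> 'X_{1..#|I| < D.+1} -> k,
    forall jc t, g jc.1 (Phi jc.2 t) = \sum_m a jc m * monomial_fun m t.
  apply: (@fin_all_exists _ (fun _ => 'X_{1..#|I| < D.+1} -> k)
    (fun jc a => forall t, g jc.1 (Phi jc.2 t) = \sum_m a m * monomial_fun m t)) => jc.
  by have := polyfun_le_span (pg jc.1 jc.2).
apply: leq_trans (leq_mul (leqnn _) (card_bmultinom _ _)).
rewrite -card_prod leqNgt; apply/negP => lt_card.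
pose G := \matrix_(i < #|J|, j < #|{: C * 'X_{1..#|I| < D.+1}}|)
   a (enum_val i, (enum_val j).1) (enum_val j).2.
have : kermx G != 0.
  rewrite -mxrank_eq0 mxrank_ker -lt0n subn_gt0.
  exact: leq_ltn_trans (rank_leq_col _) lt_card.
case/rowV0Pn => u /sub_kermxP uG u0.
case/negP: u0; apply/eqP/rowP => i; rewrite mxE.
suff /(_ (enum_val i)) : forall j, u 0 (enum_rank j) = 0 by rewrite enum_valK.
apply: indep => x /cover[c [t ->]].
rewrite (eq_bigr (fun j => \sum_m (u 0 (enum_rank j) * a (j, c) m) * monomial_fun m t));
  last by move=> j _; rewrite (aE (j, c)) mulr_sumr; apply: eq_bigr => m _; rewrite mulrA.
rewrite exchange_big big1 // => m _; rewrite -mulr_suml.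
have /rowP/(_ (enum_rank (c, m))) := uG; rewrite !mxE => uG0.
rewrite (reindex (fun i : 'I_#|J| => enum_val i)) /=; last first.
  by apply: onW_bij; exists enum_rank; [apply: enum_valK | apply: enum_rankK].
rewrite (eq_bigr (fun j => u 0 j * G j (enum_rank (c, m)))) ?uG0 ?mul0r //.
by move=> j _; rewrite enum_valK !mxE enum_rankK.
Qed.

End Counting.

(** * Chains of irreducible sets and numbers of parameters *)

Section Krull.
Variables (k : closedFieldType) (N : nat).
Implicit Types (X Y F : 'rV[k]_N -> Prop) (p q : {mpoly k[N]}) (x : 'rV[k]_N).

Definition ev p x := p.@[fun i => x ord0 i].

Lemma zclosed_ev p : zclosed (fun x => ev p x = 0).
Proof.
exists (eq p) => x; split=> [px _ <-//|]; exact.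
Qed.

Lemma zclosed_in_ev F p : zclosed_in F (fun x => F x /\ ev p x = 0).
Proof. by exists (fun x => ev p x = 0); [apply: zclosed_ev | ]. Qed.

(** The zero sets of p and of q cover F, so one of them contains F. *)
Lemma irreducible_ev_domain F p q : irreducible_set F ->
    (forall x, F x -> ev p x * ev q x = 0) -> (exists2 x, F x & ev p x <> 0) ->
  forall x, F x -> ev q x = 0.
Proof.
move=> [_ irr] pq0 [x0 Fx0 px0] x Fx.
case: (irr _ _ (zclosed_in_ev F p) (zclosed_in_ev F q)).
- move=> y Fy; have /eqP := pq0 y Fy; rewrite mulf_eq0 => /orP[]/eqP; first by left.
  by right.
- by move/(_ x0 Fx0)=> [].
- by move/(_ x Fx)=> [].
Qed.

Lemma zclosed_in_separate Y F x : zclosed_in Y F -> Y x -> ~ F x ->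
  exists2 p, (forall y, F y -> ev p y = 0) & ev p x <> 0.
Proof.
move=> [C [I CI] FE] Yx nFx.
have nCx : ~ C x by move=> Cx; apply: nFx; apply/FE.
have [p Hp] : exists p, ~ (I p -> ev p x = 0).
  by apply: not_all_ex_not => H; apply: nCx; apply/CI.
have [Ip px] := imply_to_and _ _ Hp; exists p => // y /FE[_ /CI]; exact.
Qed.

(** Exponent vectors, nested so that the last power can be split off. *)
Fixpoint power_index (e m : nat) : finType :=
  if m is m'.+1 then ('I_e * power_index e m')%type else unit.

Lemma card_power_index e m : #|power_index e m| = (e ^ m)%N.
Proof.
elim: m => [|m IH] /=; first by rewrite card_unit.
by rewrite card_prod card_ord IH expnS.
Qed.

Fixpoint power_product e (ps : seq {mpoly k[N]}) : power_index e (size ps) -> {mpoly k[N]} :=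
  if ps is p :: ps' then fun j => p ^+ j.1 * power_product j.2 else fun _ => 1.

(** Let p vanish on F m but not on F m.+1. In a relation among the products
    p^b g on F m.+1, with the g independent on F m, the lowest power of p can
    be cancelled because F m.+1 is irreducible; restricting to F m then leaves
    a relation among the g alone, so the lowest coefficients vanish. This is
    the inequality between Krull dimension and transcendence degree, stated
    with linear independence of power products in place of algebraic
    independence. *)
Lemma chain_indep Y (F : nat -> 'rV[k]_N -> Prop) m :
    (forall i, (i <= m)%N -> zclosed_in Y (F i) /\ irreducible_set (F i)) ->
    (forall i, (i < m)%N -> subset_of (F i) (F i.+1) /\ ~ subset_of (F i.+1) (F i)) ->
  exists2 ps, size ps = m &
    forall e, lin_indep_on (F m) (fun j x => ev (@power_product e ps j) x).
Proof.
elim: m => [|m IH] FY Flt.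
  exists [::] => // e c /= c0 [].
  have [_ [[x Fx] _]] := FY 0%N isT.
  have := c0 x Fx; rewrite (big_pred1 tt) => [|[]//].
  by rewrite /ev meval1 mulr1.
have [||ps sz_ps indep] := IH.
- by move=> i im; apply: FY; apply: leqW.
- by move=> i im; apply: Flt; apply: leqW.
have [Fm_sub Fm_lt] := Flt m (leqnn _).
have [x1 Hx1] := not_all_ex_not _ _ Fm_lt.
have [Fx1 nFx1] := imply_to_and _ _ Hx1.
have [[C _ FE] irrF] := FY m.+1 (leqnn _).
have [|p p0 px1] := zclosed_in_separate (FY m (leqnSn _)).1 _ nFx1.
  by case/FE: Fx1.
exists (p :: ps); first by rewrite /= sz_ps.
move=> e c c0 [b j].
have [n] := ubnP (b : nat); elim: n => // n IHn in b j *; rewrite ltnS => bn.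
have {}IHn (b' : 'I_e) j' : (b' < b)%N -> c (b', j') = 0.
  by move=> b'b; apply: IHn; apply: leq_trans b'b bn.
pose R := \sum_(b' < e | (b <= b')%N) \sum_j c (b', j) *: (p ^+ (b' - b) * power_product (e :=
    e) j).
have evR x : ev R x =
    \sum_(b' < e | (b <= b')%N) \sum_j c (b', j) * (ev p x ^+ (b' - b) * ev (power_product (e
        := e) j) x).
  rewrite /ev raddf_sum /=; apply: eq_bigr => b' _.
  rewrite raddf_sum /=; apply: eq_bigr => j' _.
  by rewrite mevalZ mevalM rmorphXn.
have R0 : forall x, F m.+1 x -> ev R x = 0.
  apply: (@irreducible_ev_domain _ (p ^+ b)) => // [x Fx|]; last first.
    exists x1 => //; rewrite /ev rmorphXn /=; apply/eqP.
    by rewrite expf_neq0 //; apply/eqP.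
  have := c0 x Fx.
  have -> : \sum_j c j * ev (power_product (ps := p :: ps) j) x =
      \sum_(b' < e) \sum_j c (b', j) * ev (power_product (ps := p :: ps) (b', j)) x.
    by rewrite pair_bigA /=; apply: eq_bigr => -[].
  rewrite (bigID (fun b' : 'I_e => (b <= b')%N)) /= [X in _ + X]big1 ?addr0; last first.
    by move=> b'; rewrite -ltnNge => b'b; apply: big1 => j' _; rewrite IHn // mul0r.
  rewrite evR => c0x; rewrite -[RHS]c0x mulr_sumr; apply: eq_bigr => b' bb'.
  rewrite mulr_sumr; apply: eq_bigr => j' _.
  rewrite /ev mevalM !rmorphXn /= -[in RHS](subnKC bb') exprD.
  by rewrite mulrCA !mulrA.
apply: (indep e (fun j => c (b, j))) j => x Fx.
have := R0 x (Fm_sub _ Fx); rewrite evR (bigD1 b) //= subnn.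
rewrite [X in _ + X]big1 ?addr0; last first.
  move=> b' /andP[bb' b'b]; apply: big1 => j' _.
  rewrite p0 // expr0n subn_eq0 [(b' <= b)%N]leqNgt ltn_neqAle bb' andbT.
  by rewrite -val_eqE eq_sym in b'b; rewrite b'b mul0r mulr0.
move=> Rx; rewrite -[RHS]Rx; apply: eq_bigr => j' _.
by rewrite expr0 mul1r.
Qed.

Lemma polyfun_le_power_product (I : finType) (phi : (I -> k) -> 'rV[k]_N) D e ps j :
  (forall p, p \in ps -> polyfun_le D (fun t => ev p (phi t))) ->
  polyfun_le (size ps * (e * D)) (fun t => ev (@power_product e ps j) (phi t)).
Proof.
elim: ps j => [|p ps IH] /= j pD.
  by apply: polyfun_le_ext (polyfun_le_const _ 1) => t; rewrite /ev meval1.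
rewrite mulSn.
have := polyfun_leM (polyfun_leX j.1 (pD p (mem_head _ _)))
   (IH j.2 (fun q qps => pD q (mem_behead (s := p :: ps) qps))).
move/(polyfun_le_weaken (d' := e * D + size ps * (e * D))) => H.
apply: polyfun_le_ext (H _) => [t|]; first by rewrite /ev mevalM rmorphXn.
by rewrite leq_add2r leq_mul2r ltnW ?orbT.
Qed.

(** For large e the e^m power products with exponents below e are independent
    on X, while in the parameters their degree is O(e), so that they span a
    space of dimension O(e^#|I|). *)
Lemma chain_le_params (C I : finType) (Phi : C -> (I -> k) -> 'rV[k]_N) X m :
    (forall c i, polyfun (fun t => Phi c t ord0 i)) ->
    (forall x, X x -> exists c t, x = Phi c t) ->
    has_irreducible_chain X m -> (m <= #|I|)%N.
Proof.
move=> polyPhi cover [F [FX Flt]]; rewrite leqNgt; apply/negP => lt_m.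
have [ps sz_ps indep] := chain_indep FX Flt.
have [D0 D0P] : exists D : C * 'I_m -> nat,
    forall cj, polyfun_le (D cj) (fun t => ev (nth 0 ps cj.2) (Phi cj.1 t)).
  apply: (@fin_all_exists (C * 'I_m)%type (fun _ => nat)
    (fun cj D => polyfun_le D (fun t => ev (nth 0 ps cj.2) (Phi cj.1 t)))) => cj.
  exact: (polyfun_meval (phi := fun i t => Phi cj.1 t ord0 i)).
pose D := \max_cj D0 cj.
have psD p c : p \in ps -> polyfun_le D (fun t => ev p (Phi c t)).
  move=> pps; have lt_p : (index p ps < m)%N by rewrite -sz_ps index_mem.
  have := D0P (c, Ordinal lt_p); rewrite /= nth_index //.
  by apply: polyfun_le_weaken; apply: leq_bigmax.
(* With exponents below e, counting gives e^m <= B e^#|I|; take e = B + 1. *)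
pose B := (#|C| * (m * D).+1 ^ #|I|)%N.
have : (#|power_index B.+1 (size ps)| <= #|C| * (m * (B.+1 * D)).+1 ^ #|I|)%N.
  apply: (chart_count (Phi := Phi) _ _ (indep B.+1)).
- by move=> x Fx; apply: cover; case: (FX m (leqnn _)).1 => Z _ /(_ x)[/(_ Fx)[]].
- by move=> j c; rewrite -{1}sz_ps; apply: polyfun_le_power_product => p; apply: psD.
rewrite card_power_index sz_ps leqNgt; case/negP.
apply: leq_ltn_trans (_ : #|C| * (B.+1 ^ #|I| * (m * D).+1 ^ #|I|) < _)%N.
  rewrite -expnMn leq_mul2l; apply/orP; right.
  by case: #|I| => // M; rewrite leq_exp2r // mulnS mulnCA; lia.
rewrite mulnCA -/B mulnC (@leq_trans (B.+1 ^ #|I|.+1)) //.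
  by rewrite expnS ltn_mul2r ltnSn andbT expn_gt0.
by apply: leq_pexp2l.
Qed.

End Krull.

(** * Chains obtained from a chart *)

Section Chains.
Variables (k : closedFieldType) (N : nat).
Implicit Types (X Y F : 'rV[k]_N -> Prop) (p q : {mpoly k[N]}) (x : 'rV[k]_N).

Lemma zclosed_in_trans X Y F : zclosed_in X Y -> zclosed_in Y F -> zclosed_in X F.
Proof.
move=> [C1 [I1 C1E] YE] [C2 [I2 C2E] FE].
exists (fun x => C1 x /\ C2 x); last first.
  move=> x; rewrite FE YE; tauto.
exists (fun p => I1 p \/ I2 p) => x; rewrite C1E C2E; split.
  by move=> [H1 H2] p []; [apply: H1 | apply: H2].
by move=> H; split=> p Ip; apply: H; [left | right].
Qed.

Lemma dim_ge_chain X m : dim_ge X m -> has_irreducible_chain X m.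
Proof.
move=> [Y [YX _ _] [F [FY Flt]]]; exists F; split=> // i im.
by have [Fi irr] := FY i im; split=> //; apply: zclosed_in_trans YX Fi.
Qed.

(** The top of a chain of maximal length is an irreducible component: a larger
    irreducible closed set would prolong the chain. *)
Lemma chain_dim_ge X m :
  has_irreducible_chain X m -> ~ has_irreducible_chain X m.+1 -> dim_ge X m.
Proof.
move=> [F [FX Flt]] nchain.
have Fsub i : (i <= m)%N -> subset_of (F i) (F m).
  move=> im; rewrite -(subKn im); elim: (m - i)%N (leq_subr i m) => [|j IH] jm.
    by rewrite subn0.
  move=> x Fx; apply: IH; first exact: ltnW.
  have lt_m : (m - j.+1 < m)%N by lia.
  have [+ _] := Flt _ lt_m; rewrite subnSK //; exact.
exists (F m); last first.
  exists F; split=> // i im; have [[C Ccl FE] irr] := FX i im; split=> //.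
  exists C => // x; split=> [Fx|[Fx Cx]].
    by split; [apply: Fsub Fx | case/FE: Fx].
  by apply/FE; split=> //; case: (FX m (leqnn _)).1 => Z _ /(_ x)[/(_ Fx)[]].
have [FXm irrm] := FX m (leqnn _).
split=> // Y YX irrY FY; apply: NNPP => nYF; apply: nchain.
exists (fun i => if (i <= m)%N then F i else Y); split=> i im.
  by case: ifP => // im'; apply: FX.
have im' : (i <= m)%N by []; rewrite im'.
case: ltnP => [lt_im|mi]; first exact: Flt.
by have -> : i = m by [apply/eqP; rewrite eqn_leq im' mi].
Qed.

(** A root of 1 + X p is not a root of p. *)
Lemma poly_nonroot (p : {poly k}) : p != 0 -> exists s, p.[s] != 0.
Proof.
move=> p0; have : size (1 + 'X * p) != 1%N.
  rewrite addrC size_polyDl; rewrite mulrC size_mulX // ?size_poly1.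
    by rewrite eqSS size_poly_eq0.
  by rewrite ltnS lt0n size_poly_eq0.
case/closed_rootP => s /rootP; rewrite !hornerE => sp; exists s.
by apply: contra_eq_neq sp => ->; rewrite mulr0 addr0 oner_neq0.
Qed.

Section Chart.
Variables (I : finType) (phi : (I -> k) -> 'rV[k]_N) (h : (I -> k) -> k).
Hypothesis poly_phi : forall j, polyfun (fun t => phi t ord0 j).
Hypothesis poly_h : polyfun h.

Lemma polyfun_ev_chart q : polyfun (fun t => ev q (phi t)).
Proof. exact: (polyfun_meval (phi := fun i t => phi t ord0 i)). Qed.

Lemma line_avoid (f g : (I -> k) -> k) t0 t1 :
  polyfun f -> polyfun g -> h t0 != 0 -> f t0 != 0 -> g t1 != 0 ->
  exists s, let t := (fun i => t0 i + s * (t1 i - t0 i)) in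
    [/\ h t != 0, f t != 0 & g t != 0].
Proof.
move=> pf pg h0 f0 g1.
have [qh Eh] := polyfun_line t0 t1 poly_h.
have [qf Ef] := polyfun_line t0 t1 pf.
have [qg Eg] := polyfun_line t0 t1 pg.
have ext0 (F : (I -> k) -> k) : polyfun F -> F (fun i => t0 i + 0 * (t1 i - t0 i)) = F t0.
  by move=> [d [p _ FE]]; rewrite !FE; apply: meval_eq => i; rewrite mul0r addr0.
have ext1 (F : (I -> k) -> k) : polyfun F -> F (fun i => t0 i + 1 * (t1 i - t0 i)) = F t1.
  by move=> [d [p _ FE]]; rewrite !FE; apply: meval_eq => i; rewrite mul1r subrKC.
have nz (F : (I -> k) -> k) (q : {poly k}) t s : F t != 0 -> F t = q.[s] -> q != 0.
  by move=> Ft FE; apply: contra_neq Ft => q0; rewrite FE q0 horner0.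
have /poly_nonroot[s] : qh * (qf * qg) != 0.
  rewrite !mulf_neq0 //.
  - by apply: (nz _ _ _ 0 h0); rewrite -Eh ext0.
  - by apply: (nz _ _ _ 0 f0); rewrite -Ef ext0.
  - by apply: (nz _ _ _ 1 g1); rewrite -Eg ext1.
rewrite !hornerM !mulf_eq0 !negb_or => /and3P[hs fs gs]; exists s.
by rewrite /= Eh Ef Eg.
Qed.

(** The closure in X of the image under phi of the points of P at which h does
    not vanish. *)
Definition chart_closure X (P : (I -> k) -> Prop) x :=
  X x /\ forall q, (forall t, P t -> h t != 0 -> ev q (phi t) = 0) -> ev q x = 0.

Lemma zclosed_chart_closure X P : zclosed_in X (chart_closure X P).
Proof.
by exists (fun x => forall q,
  (forall t, P t -> h t != 0 -> ev q (phi t) = 0) -> ev q x = 0) => //;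
  exists (fun q => forall t, P t -> h t != 0 -> ev q (phi t) = 0).
Qed.

(** If q1 and q2 do not vanish identically, join a point where q1 does not
    vanish to one where q2 does not by a line in P: a general point of the
    line avoids the zeros of q1, of q2 and of h. *)
Lemma irreducible_chart_closure X (P : (I -> k) -> Prop) :
    (forall t, h t != 0 -> X (phi t)) ->
    (exists2 t, P t & h t != 0) ->
    (forall t0 t1 s, P t0 -> P t1 -> P (fun i => t0 i + s * (t1 i - t0 i))) ->
  irreducible_set (chart_closure X P).
Proof.
move=> Xphi [t Pt ht] Pline; split.
  by exists (phi t); split=> [|q]; [apply: Xphi | apply].
have escape C : zclosed_in (chart_closure X P) C -> ~ subset_of (chart_closure X P) C ->
    exists q t, [/\ forall x, C x -> ev q x = 0, P t, h t != 0 & ev q (phi t) != 0].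
  move=> Ccl nsub.
  have [x Hx] := not_all_ex_not _ _ nsub.
  have [Fx nCx] := imply_to_and _ _ Hx.
  have [q qC qx] := zclosed_in_separate Ccl Fx nCx; exists q.
  apply: NNPP => nt; apply: qx; apply: Fx.2 => u Pu hu.
  by apply/eqP; apply: contra_notT nt => qu; exists u.
move=> C1 C2 C1cl C2cl cover.
apply: NNPP => /not_or_and[/(escape _ C1cl)[q1 [t1 [q1C Pt1 ht1 q1t]]]].
move=> /(escape _ C2cl)[q2 [t2 [q2C Pt2 ht2 q2t]]].
have [s /= [hs fs gs]] :=
  line_avoid (polyfun_ev_chart q1) (polyfun_ev_chart q2) ht1 q1t q2t.
set u := (fun i => _) in hs fs gs.
have : chart_closure X P (phi u).
  by split=> [|q]; [apply: Xphi | apply=> //; apply: Pline].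
by move/cover => [/q1C | /q2C] /eqP; apply/negP.
Qed.

(** Sort the coordinates by level and let the m-th set be the closure of the
    image of the first m coordinates. If i is the next coordinate, p i
    vanishes on this image, where t i and all coordinates of higher level are
    zero, but not at a general point of the i-th axis, where p i restricts to
    t i * e i. The hypothesis on p i thus replaces a polynomial inverse of the
    chart by one that is triangular with respect to the levels. *)
Lemma chain_of_chart X (lvl : I -> nat) (p : I -> {mpoly k[N]}) (e : I -> (I -> k) -> k) :
    h (fun _ => 0) != 0 ->
    (forall t, h t != 0 -> X (phi t)) ->
    (forall i, polyfun (e i)) -> (forall i, e i (fun _ => 0) != 0) ->
    (forall i t, (forall j, (lvl i < lvl j)%N -> t j = 0) ->
       ev (p i) (phi t) = t i * e i t) ->
  has_irreducible_chain X #|I|.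
Proof.
move=> h0 Xphi poly_e e0 pE.
pose s := sort (relpre lvl leq) (enum I).
have mem_s i : i \in s by rewrite mem_sort mem_enum.
have sz_s : size s = #|I| by rewrite size_sort -cardE.
have uniq_s : uniq s by rewrite sort_uniq enum_uniq.
have sort_s i j : (lvl i < lvl j)%N -> (index i s < index j s)%N.
  move=> ij; rewrite ltnNge; apply/negP => ji.
  have : sorted (relpre lvl leq) s.
    by apply: sort_sorted => a b /=; apply: leq_total.
  move/(sorted_leq_index _ _) => /(_ (fun a b c => @leq_trans _ _ _) (fun a => leqnn _)).
  by move/(_ j i (mem_s _) (mem_s _) ji) => /=; rewrite leqNgt ij.
pose P m (t : I -> k) := forall i, (m <= index i s)%N -> t i = 0.
exists (fun m => chart_closure X (P m)); split=> m le_m.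
  split; first exact: zclosed_chart_closure.
  apply: irreducible_chart_closure => //; first by exists (fun _ => 0).
  by move=> t0 t1 a P0 P1 i mi; rewrite P0 // P1 // subrr mulr0 addr0.
split.
  move=> x [Xx Fx]; split=> // q q0; apply: Fx => t Pt; apply: q0 => i mi.
  by apply: Pt; apply: ltnW.
have [i0] : exists i0 : I, true by move: (leq_ltn_trans (leq0n _) le_m) => /card_gt0P[i0];
    exists i0.
move=> _; set i := nth i0 s m => sub.
have idx_i : index i s = m by rewrite index_uniq // sz_s.
pose d t : I -> k := fun j => if j == i then t else 0.
have [|a /= [ha ea da]] := line_avoid (f := e i) (g := fun t => t i) (t0 := fun=> 0) (t1 := d 1)
  (poly_e i) (polyfun_var k i) h0 (e0 i).
  by rewrite /d eqxx oner_neq0.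
set t := (fun j => _) in ha ea da.
have Pt : P m.+1 t.
  move=> j mj; rewrite /t /d; case: eqP => [ji|_]; last by rewrite subrr mulr0 addr0.
  by move: mj; rewrite ji idx_i ltnn.
have /sub[_ /(_ (p i))] : chart_closure X (P m.+1) (phi t).
  by split=> [|q]; [apply: Xphi | apply].
have lvl0 m' (u : I -> k) : (m' <= m.+1)%N -> P m' u -> forall j, (lvl i < lvl j)%N -> u j = 0.
  by move=> m'm Pu j /sort_s; rewrite idx_i => mj; apply: Pu; apply: leq_trans mj.
move=> pt0; have : ev (p i) (phi t) = 0.
  by apply: pt0 => u Pu _; rewrite pE ?Pu ?mul0r ?idx_i //; apply: lvl0 Pu.
rewrite pE; last by apply: lvl0 Pt.
by apply/eqP; rewrite mulf_neq0.
Qed.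

End Chart.
End Chains.

(** * Hyperbolic bases of a symmetric form *)

Lemma trmxD (R : nmodType) m n (A B : 'M[R]_(m, n)) : (A + B)^T = A^T + B^T.
Proof. by apply/matrixP => i j; rewrite !mxE. Qed.

Lemma trmxN (R : zmodType) m n (A : 'M[R]_(m, n)) : (- A)^T = - A^T.
Proof. by apply/matrixP => i j; rewrite !mxE. Qed.

Lemma trmxZ (R : pzRingType) m n (a : R) (A : 'M[R]_(m, n)) : (a *: A)^T = a *: A^T.
Proof. by apply/matrixP => i j; rewrite !mxE. Qed.

Lemma gram_row_mx (R : pzRingType) n p q (F : 'M[R]_n) (X : 'M_(n, p)) (K : 'M_(n, q)) :
  (row_mx X K)^T *m F *m row_mx X K =
  block_mx (X^T *m F *m X) (X^T *m F *m K) (K^T *m F *m X) (K^T *m F *m K).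
Proof. by rewrite tr_row_mx mul_col_mx mul_col_row. Qed.

Section Forms.
Variable k : closedFieldType.
Hypothesis char2 : 2%N \notin [pchar k].

Lemma two_neq0 : 2%:R != 0 :> k.
Proof. by apply: contra char2 => two0; rewrite inE /= two0. Qed.

Lemma exists_sqrt (x : k) : exists y, y ^+ 2 = x.
Proof.
have : size ('X^2 - x%:P) != 1%N by rewrite size_XnsubC.
case/closed_rootP => y /rootP; rewrite !hornerE => /eqP.
by rewrite subr_eq0 => /eqP; exists y.
Qed.

Lemma kernel_basis (p m n : nat) (M : 'M[k]_(p, n)) : n = (p + m)%N -> row_free M ->
  exists2 K : 'M_(n, m), M *m K = 0 & row_free K^T.
Proof.
move=> En /eqP rM.
have Em : \rank (cokermx M) = m by rewrite mxrank_coker rM En addKn.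
rewrite -Em; exists (col_base (cokermx M)); last first.
  by rewrite /row_free mxrank_tr; apply: col_base_full.
apply: (row_free_inj (row_base_free (cokermx M))).
by rewrite mul0mx -mulmxA mulmx_base mulmx_coker.
Qed.

Lemma orthogonal_complement (p m n : nat) (F : 'M[k]_n) (X : 'M_(n, p)) :
    n = (p + m)%N -> F^T = F -> F \in unitmx -> X^T *m F *m X \in unitmx ->
  exists2 K : 'M_(n, m), X^T *m F *m K = 0 & K^T *m F *m K \in unitmx.
Proof.
move=> En; subst n => symF unitF unitX.
have [|K XFK freeK] := kernel_basis (M := X^T *m F) erefl.
  by rewrite -row_leq_rank; apply: leq_trans (mxrankM_maxl _ X); rewrite mxrank_unit.
exists K => //.
have KFX : K^T *m F *m X = 0.
  by apply: trmx_inj; rewrite !trmx_mul trmxK symF mulmxA XFK trmx0.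
pose P := row_mx X K.
have PFP : P^T *m F *m P = block_mx (X^T *m F *m X) 0 0 (K^T *m F *m K).
  by rewrite gram_row_mx XFK KFX.
have unitP : P \in unitmx.
  rewrite -unitmx_tr -row_free_unit -kermx_eq0; apply/rowV0P => u /sub_kermxP.
  rewrite tr_row_mx -[u]hsubmxK mul_row_col; set a := lsubmx u; set b := rsubmx u => ab0.
  have a0 : a = 0.
    have /(congr1 (mulmx^~ (F *m X))) := ab0.
    rewrite mulmxDl -!mulmxA [K^T *m _]mulmxA KFX mulmx0 addr0 mul0mx.
    rewrite [X^T *m _]mulmxA => aJ.
    by rewrite -[a](mulmxK unitX) aJ mul0mx.
  have b0 : b = 0.
    apply: (row_free_inj freeK); move: ab0.
    by rewrite a0 !mul0mx add0r.
  by rewrite a0 b0 row_mx0.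
have : P^T *m F *m P \in unitmx by rewrite !unitmx_mul unitmx_tr unitP unitF.
by rewrite PFP !unitmxE det_ublock unitrM => /andP[].
Qed.

(** If all diagonal entries vanish, polarization gives a vector of square 2 F
    i j. *)
Lemma exists_anisotropic n (F : 'M[k]_n.+1) : F^T = F -> F \in unitmx ->
  exists v : 'cV_n.+1, v^T *m F *m v = 1%:M.
Proof.
move=> symF unitF.
have dE i j : (delta_mx i 0 : 'cV[k]_n.+1)^T *m F *m delta_mx j 0 = (F i j)%:M.
  rewrite trmx_delta -rowE -colE; apply/matrixP => a b.
  by rewrite !ord1 !mxE eqxx mulr1n.
suff [v [c c0 vFv]] : exists v : 'cV_n.+1, exists2 c, c != 0 & v^T *m F *m v = c%:M.
  have [y y2] := exists_sqrt c; have y0 : y != 0 by apply: contra_neq c0 => y0; rewrite -y2 y0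
      expr0n.
  exists (y^-1 *: v).
  rewrite trmxZ -!scalemxAl -scalemxAr vFv -y2 !scale_scalar_mx.
  by congr (_%:M); field.
have [i [j Fij]] : exists i j, F i j != 0.
  apply: NNPP => H; move: unitF; have -> : F = 0.
    apply/matrixP => i j; rewrite mxE; apply/eqP; apply: contra_notT H => Fij.
    by exists i, j.
  by rewrite unitmxE det0 unitr0.
have [Fii|Fii] := eqVneq (F i i) 0; last by exists (delta_mx i 0), (F i i).
have [Fjj|Fjj] := eqVneq (F j j) 0; last by exists (delta_mx j 0), (F j j).
exists (delta_mx i 0 + delta_mx j 0), (2%:R * F i j); first by rewrite mulf_neq0 ?two_neq0.
rewrite trmxD !mulmxDl !mulmxDr !dE Fii Fjj.
have -> : F j i = F i j by rewrite -{1}symF mxE.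
by apply/matrixP => a b; rewrite !ord1 !mxE eqxx !mulr1n; ring.
Qed.

Lemma orthonormal_basis n (F : 'M[k]_n) : F^T = F -> F \in unitmx ->
  exists O : 'M_n, O^T *m F *m O = 1%:M.
Proof.
elim: n F => [|n IH] F symF unitF; first by exists 0; apply/matrixP => -[].
have [v vFv] := exists_anisotropic symF unitF.
have [|K vFK unitK] := orthogonal_complement (p := 1) (m := n) (X := v) erefl symF unitF.
  by rewrite vFv unitmx1.
have [|O' KO] := IH _ _ unitK; first by rewrite !trmx_mul trmxK symF mulmxA.
exists (row_mx v (K *m O') : 'M_(1 + n)).
have KFv : K^T *m F *m v = 0.
  by apply: trmx_inj; rewrite !trmx_mul trmxK symF mulmxA vFK trmx0.
apply: (etrans (gram_row_mx F v (K *m O'))).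
have -> : (K *m O')^T *m F *m v = O'^T *m (K^T *m F *m v) by rewrite trmx_mul !mulmxA.
have -> : (K *m O')^T *m F *m (K *m O') = O'^T *m (K^T *m F *m K) *m O'.
  by rewrite trmx_mul !mulmxA.
have -> : v^T *m F *m (K *m O') = 0 by rewrite mulmxA vFK mul0mx.
by rewrite vFv KFv mulmx0 KO -scalar_mx_block.
Qed.

(** The Gram matrix of a basis adapted to L + U + L', with L and L' dual
    isotropic subspaces of dimension l and U orthogonal to both with an
    orthonormal basis of m vectors. *)
Definition hyp_form (l m : nat) : 'M[k]_(l + (m + l)) :=
  block_mx 0 (row_mx 0 1%:M) (col_mx 0 1%:M) (block_mx 1%:M 0 0 0).

Lemma hyp_form_tr l m : (hyp_form l m)^T = hyp_form l m.
Proof. by rewrite /hyp_form !(tr_block_mx, tr_row_mx, tr_col_mx, trmx0, trmx1). Qed.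

Lemma hyp_form_sq l m : hyp_form l m *m hyp_form l m = 1%:M.
Proof.
rewrite /hyp_form !(mulmx_block, mul_row_col, mul_row_block, mul_block_col, mul_col_row).
rewrite !(mul0mx, mulmx0, mul1mx, mulmx1, addr0, add0r, add_block_mx).
by rewrite row_mx0 col_mx0 -!scalar_mx_block.
Qed.

Lemma hyp_form_unit l m : hyp_form l m \in unitmx.
Proof. by have [] := mulmx1_unit (hyp_form_sq l m). Qed.

Lemma exists_hyp_basis l m (F : 'M[k]_(l + (m + l))) :
  F^T = F -> F \in unitmx -> exists P : 'M_(l + (m + l)), P^T *m F *m P = hyp_form l m.
Proof.
move=> symF unitF; have [O OFO] := orthonormal_basis symF unitF.
have [O' OHO] := orthonormal_basis (hyp_form_tr l m) (hyp_form_unit l m).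
have unitO' : O' \in unitmx by have [] := mulmx1_unit OHO.
exists (O *m invmx O').
have -> : hyp_form l m = (invmx O')^T *m (O'^T *m hyp_form l m *m O') *m invmx O'.
  by rewrite trmx_inv !mulmxA mulVmx ?unitmx_tr // mul1mx mulmxK.
by rewrite OHO -OFO trmx_mul !mulmxA.
Qed.

(** A family N dual to X exists because the form is nondegenerate, and becomes
    isotropic after subtracting X times half of its Gram matrix; what is left
    is the orthogonal complement of the hyperbolic space so obtained, which
    has an orthonormal basis. *)
Lemma witt_isotropic l m (F : 'M[k]_(l + (m + l))) (X : 'M_(l + (m + l), l)) :
    F^T = F -> F \in unitmx -> row_free X^T -> X^T *m F *m X = 0 ->
  exists2 P : 'M_(l + (m + l)), P^T *m F *m P = hyp_form l m & lsubmx P = X.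
Proof.
move=> symF unitF freeX XFX.
have FT p q (A : 'M_(_, p)) (B : 'M_(_, q)) : (A^T *m F *m B)^T = B^T *m F *m A.
  by rewrite !trmx_mul trmxK symF mulmxA.
have [N XFN] : exists N : 'M_(_, l), X^T *m F *m N = 1%:M.
  apply/row_freeP; rewrite /row_free mxrankMfree //.
  by rewrite row_free_unit.
pose Y := N - 2%:R^-1 *: (X *m (N^T *m F *m N)).
have NFX : N^T *m F *m X = 1%:M by rewrite -FT XFN trmx1.
have XFY : X^T *m F *m Y = 1%:M.
  by rewrite mulmxBr -scalemxAr [_ *m (X *m _)]mulmxA XFX mul0mx scaler0 subr0.
have YFX : Y^T *m F *m X = 1%:M by rewrite -FT XFY trmx1.
have NFY : N^T *m F *m Y = 2%:R^-1 *: (N^T *m F *m N).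
  rewrite mulmxBr -scalemxAr [_ *m (X *m _)]mulmxA NFX mul1mx.
  rewrite -{1}[N^T *m F *m N]scale1r -scalerBl; congr (_ *: _).
  by field; apply: two_neq0.
have YFY : Y^T *m F *m Y = 0.
  have -> : Y^T *m F *m Y = N^T *m F *m Y
      - 2%:R^-1 *: ((N^T *m F *m N)^T *m (X^T *m F *m Y)).
    by rewrite {1}/Y trmxD trmxN trmxZ trmx_mul !mulmxDl !mulNmx -!scalemxAl !mulmxA.
  by rewrite NFY XFY mulmx1 FT subrr.
pose H := row_mx X Y.
have HFH : H^T *m F *m H = block_mx 0 1%:M 1%:M 0.
  by rewrite gram_row_mx XFX XFY YFX YFY.
have [||K HFK unitK] := orthogonal_complement (p := l + l) (m := m) (X := H) _ symF unitF.
- by rewrite addnCA addnC -addnA addnC -addnA.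
- have : H^T *m F *m H *m (H^T *m F *m H) = 1%:M.
    rewrite HFH mulmx_block !(mul0mx, mulmx0, mul1mx, addr0, add0r).
    by rewrite -scalar_mx_block.
  by case/mulmx1_unit.
have [|O KO] := orthonormal_basis _ unitK; first by rewrite FT.
move: HFK; rewrite tr_row_mx mul_col_mx mul_col_mx -col_mx0 => /eq_col_mx[XFK YFK].
have KFX : K^T *m F *m X = 0 by rewrite -FT XFK trmx0.
have KFY : K^T *m F *m Y = 0 by rewrite -FT YFK trmx0.
exists (row_mx X (row_mx (K *m O) Y)); last by rewrite row_mxKl.
rewrite !tr_row_mx !mul_col_mx !mul_mx_row trmx_mul.
have assoc q (A : 'M_(_, q)) : O^T *m K^T *m F *m A = O^T *m (K^T *m F *m A) by rewrite !mulmxA.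
rewrite !assoc !(mulmxA _ K O) XFX XFY YFX YFY XFK YFK KFX KFY.
rewrite !(mul0mx, mulmx0) mulmxA KO /hyp_form.
by rewrite block_mxEv; congr col_mx; rewrite block_mxEv -block_mxEh block_mxEv.
Qed.

End Forms.

(** * Block shapes in a hyperbolic basis *)

Section Shapes.
Variable k : closedFieldType.

(** In a basis adapted to L + U + L', the endomorphisms that preserve L and
    its orthogonal L + U; C is the action induced on U. *)
Definition ut_mx l m (a : 'M[k]_l) (x : 'M_(l, m)) (c : 'M_l) (C : 'M_m)
    (y : 'M_(m, l)) (b : 'M_l) : 'M_(l + (m + l)) :=
  block_mx a (row_mx x c) 0 (block_mx C y 0 b).

(** When isotropic_graph Y Z holds this is an isometry, carrying the standard
    isotropic subspace to the span of the columns of (1, Y, Z). These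
    isometries describe a neighbourhood of L among the isotropic subspaces. *)
Definition unip_mx l m (Y : 'M[k]_(m, l)) (Z : 'M_l) : 'M_(l + (m + l)) :=
  block_mx 1%:M 0 (col_mx Y Z) (block_mx 1%:M 0 (- Y^T) 1%:M).

Definition unip_inv l m (Y : 'M[k]_(m, l)) (Z : 'M_l) : 'M_(l + (m + l)) :=
  block_mx 1%:M 0 (col_mx (- Y) Z^T) (block_mx 1%:M 0 Y^T 1%:M).

(** The columns of (1, Y, Z) span an isotropic subspace for hyp_form. *)
Definition isotropic_graph l m (Y : 'M[k]_(m, l)) (Z : 'M_l) := Z + Z^T + Y^T *m Y = 0.

Lemma unip_mxV l m (Y : 'M[k]_(m, l)) Z : isotropic_graph Y Z ->
  unip_mx Y Z *m unip_inv Y Z = 1%:M.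
Proof.
move=> iso; rewrite /unip_mx /unip_inv.
rewrite !(mulmx_block, mul_block_col, mul1mx, mulmx1, mul0mx, mulmx0, addr0, add0r).
rewrite add_col_mx subrr mulNmx mulmxN opprK addrCA [Y^T *m Y + _]addrC iso.
by rewrite col_mx0 addNr -!scalar_mx_block.
Qed.

Lemma unip_mx_form l m (Y : 'M[k]_(m, l)) Z : isotropic_graph Y Z ->
  (unip_mx Y Z)^T *m hyp_form k l m *m unip_mx Y Z = hyp_form k l m.
Proof.
move=> iso; rewrite /unip_mx /hyp_form.
rewrite !(tr_block_mx, tr_row_mx, tr_col_mx, trmx0, trmx1, trmxN, trmxK).
rewrite !(mulmx_block, mul_block_col, mul_row_block, mul_row_col, mul_col_row,
  mul_mx_row, mul_col_mx, mul1mx, mulmx1, mul0mx, mulmx0, addr0, add0r, add_row_mx, add_col_mx).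
by rewrite subrr addNr addrA [_ + Z]addrC addrA iso.
Qed.

Lemma lsubmx_unip_mx l m (Y : 'M[k]_(m, l)) Z :
  lsubmx (unip_mx Y Z) = col_mx 1%:M (col_mx Y Z).
Proof. by rewrite /unip_mx block_mxEh row_mxKl. Qed.

Lemma block3_adjoint l m (a : 'M[k]_l) (x : 'M_(l, m)) c p q C y z b :
  hyp_form k l m *m (block_mx a (row_mx x c) (col_mx p q) (block_mx C y z b))^T
    *m hyp_form k l m =
  block_mx b^T (row_mx y^T c^T) (col_mx z^T q^T) (block_mx C^T x^T p^T a^T).
Proof.
rewrite /hyp_form.
rewrite !(tr_block_mx, tr_row_mx, tr_col_mx, trmx0, trmx1, trmxN, trmxK).
rewrite !(mulmx_block, mul_block_col, mul_row_block, mul_row_col, mul_col_row,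
  mul_mx_row, mul_col_mx, mul1mx, mulmx1, mul0mx, mulmx0, addr0, add0r, add_row_mx, add_col_mx,
      add_block_mx).
congr (block_mx _ _ _ _).
by rewrite [in LHS]block_mxEh add_row_mx add0r col_mx0 addr0 -block_mxEh.
Qed.

Lemma ut_mx_adjoint l m (a : 'M[k]_l) (x : 'M_(l, m)) c C y b :
  hyp_form k l m *m (ut_mx a x c C y b)^T *m hyp_form k l m =
  ut_mx b^T y^T c^T C^T x^T a^T.
Proof. by rewrite /ut_mx -col_mx0 block3_adjoint !trmx0 !col_mx0. Qed.

Lemma lsubmx_ut_mx l m (a : 'M[k]_l) (x : 'M_(l, m)) c C y b :
  lsubmx (ut_mx a x c C y b) = col_mx a 0.
Proof. by rewrite /ut_mx block_mxEh row_mxKl. Qed.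

Lemma hyp_basis_unit l m (F : 'M[k]_(l + (m + l))) (h : 'M_(l + (m + l))) :
  h^T *m F *m h = hyp_form k l m -> h \in unitmx.
Proof.
move=> hF; have := hyp_form_unit k l m.
by rewrite -hF !unitmx_mul => /andP[].
Qed.

(** The hypothesis on As says that it is the adjoint of A. Adjunction
    exchanges the first block column with the last block row, so stability of
    L under the adjoint makes the blocks of A to the left of its last diagonal
    block vanish. *)
Lemma adapted_shape l m (F A As : 'M[k]_(l + (m + l))) (h : 'M_(l + (m + l)))
    (R R' : 'M_l) :
    h^T *m F *m h = hyp_form k l m -> As^T *m F = F *m A ->
    A *m lsubmx h = lsubmx h *m R -> As *m lsubmx h = lsubmx h *m R' ->
  exists x c C y, A *m h = h *m ut_mx R x c C y R'^T /\
                  As *m h = h *m ut_mx R' y^T c^T C^T x^T R^T.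
Proof.
move=> hF adj AX AsX; have unith := hyp_basis_unit hF.
have conj (M : 'M_(l + (m + l))) : exists N, M *m h = h *m N.
  by exists (invmx h *m M *m h); rewrite !mulmxA mulmxV // mul1mx.
have [[B hB] [Bs hBs]] := (conj A, conj As).
have lsub (M N : 'M_(l + (m + l))) (S : 'M_l) : M *m h = h *m N ->
    M *m lsubmx h = lsubmx h *m S -> lsubmx N = col_mx S 0.
  move=> MN MS; apply: (can_inj (mulKmx unith)); rewrite mulmx_lsub -MN -mulmx_lsub MS.
  by rewrite -{2}[h]hsubmxK mul_row_col mulmx0 addr0.
have FB : Bs = hyp_form k l m *m B^T *m hyp_form k l m.
  have E : Bs^T *m hyp_form k l m = hyp_form k l m *m B.
    transitivity (h^T *m (As^T *m F) *m h).
      by rewrite -hF !mulmxA -trmx_mul -hBs trmx_mul.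
    by rewrite adj -!mulmxA hB -hF !mulmxA.
  have /(congr1 trmx) := E; rewrite !trmx_mul trmxK hyp_form_tr => {}E; rewrite -mulmxA -E.
  by rewrite mulmxA hyp_form_sq mul1mx.
have := lsub _ _ _ hB AX; have := lsub _ _ _ hBs AsX.
rewrite FB -[B]submxK -[ursubmx B]hsubmxK -[drsubmx B]submxK -[dlsubmx B]vsubmxK.
rewrite block3_adjoint !block_mxEh !row_mxKl -!col_mx0.
move=> /eq_col_mx[<- /eq_col_mx[/(canRL trmxK) + _]].
move=> z0 /eq_col_mx[aR /eq_col_mx[p0 q0]]; rewrite trmx0 in z0.
have BE : B = ut_mx R (lsubmx (ursubmx B)) (rsubmx (ursubmx B))
    (ulsubmx (drsubmx B)) (ursubmx (drsubmx B)) (drsubmx (drsubmx B)).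
  rewrite /ut_mx -z0 -aR -[in RHS](col_mx0) -p0 -q0 submxK hsubmxK.
  by rewrite vsubmxK submxK.
exists (lsubmx (ursubmx B)), (rsubmx (ursubmx B)), (ulsubmx (drsubmx B)), (ursubmx (drsubmx B)).
by rewrite trmxK -BE hB; split=> //; rewrite hBs FB {1}BE ut_mx_adjoint.
Qed.

(** The first e columns span the graph of Y, the others its orthogonal for the
    dot product. *)
Definition orth_mx e f (Y : 'M[k]_(f, e)) : 'M_(e + f) := block_mx 1%:M (- Y^T) Y 1%:M.

Lemma orth_mx_gram e f (Y : 'M[k]_(f, e)) :
  (orth_mx Y)^T *m orth_mx Y =
  block_mx (1%:M + Y^T *m Y) 0 0 (1%:M + Y *m Y^T).
Proof.
rewrite /orth_mx tr_block_mx mulmx_block !trmx1 trmxN trmxK.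
rewrite !(mul1mx, mulmx1) !addNr mulNmx mulmxN opprK.
by rewrite [_ + 1%:M]addrC.
Qed.

Lemma gram_complement_unit e f (Y : 'M[k]_(f, e)) :
  1%:M + Y^T *m Y \in unitmx -> 1%:M + Y *m Y^T \in unitmx.
Proof.
move=> unitY; rewrite -row_free_unit -kermx_eq0; apply/rowV0P => u /sub_kermxP.
rewrite mulmxDr mulmx1 => u0.
have uY : u *m Y = 0.
  have /(congr1 (mulmx^~ Y)) := u0; rewrite mul0mx mulmxDl mulmxA -!mulmxA.
  rewrite mulmxA -{1}[u *m Y]mulmx1 -mulmxDr => uY.
  by rewrite -[u *m Y](mulmxK unitY) uY mul0mx.
by move: u0; rewrite mulmxA uY mul0mx addr0.
Qed.

(** With P = orth_mx Y, both G = P^T P and P^T C P are block diagonal. As P^-1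
    = G^-1 P^T, the matrix C equals P D P^T with D = G^-1 (P^T C P) G^-1. This
    form is polynomial in Y and D. *)
Lemma stable_graph_shape e f (Y : 'M[k]_(f, e)) (C : 'M_(e + f)) (R R' : 'M_e) :
    let X := col_mx 1%:M Y in
    C *m X = X *m R -> C^T *m X = X *m R' -> X^T *m X \in unitmx ->
  exists D1 D2, C = orth_mx Y *m block_mx D1 0 0 D2 *m (orth_mx Y)^T.
Proof.
move=> X CX CTX.
have -> : X^T *m X = 1%:M + Y^T *m Y by rewrite tr_col_mx mul_row_col trmx1 mul1mx.
move=> unit1; have unit2 := gram_complement_unit unit1.
set G1 := (_ + _) in unit1; set G2 := (_ + _) in unit2.
pose P := orth_mx Y; pose X' := col_mx (- Y^T) 1%:M : 'M_(e + f, f).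
have PE : P = row_mx X X' by rewrite /P /orth_mx block_mxEh.
have XX' : X^T *m X' = 0.
  by rewrite tr_col_mx mul_row_col trmx1 mul1mx mulmx1 addNr.
have X'X : X'^T *m X = 0.
  by apply: trmx_inj; rewrite trmx_mul trmxK XX' trmx0.
have PCP : P^T *m C *m P = block_mx (X^T *m C *m X) 0 0 (X'^T *m C *m X').
  rewrite PE gram_row_mx -!mulmxA CX !mulmxA X'X mul0mx.
  by rewrite -[X^T *m C]trmxK trmx_mul trmxK CTX trmx_mul -!mulmxA XX' mulmx0.
have PP : P^T *m P = block_mx G1 0 0 G2 by apply: orth_mx_gram.
have unitP : P \in unitmx.
  have : P^T *m P \in unitmx by rewrite PP unitmxE det_ublock unitrM -!unitmxE unit1.
  by rewrite unitmx_mul => /andP[].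
exists (invmx G1 *m (X^T *m C *m X) *m invmx G1), (invmx G2 *m (X'^T *m C *m X') *m invmx G2).
apply: (can_inj (mulKmx (_ : P^T \in unitmx))); first by rewrite unitmx_tr.
apply: (can_inj (mulmxK unitP)); rewrite PCP -/P.
rewrite !mulmxA -[_ *m P^T *m P]mulmxA PP.
rewrite !mulmx_block !(mul0mx, mulmx0, addr0, add0r) !mulmxA.
by rewrite !mulmxV // !mul1mx !mulmxKV.
Qed.

End Shapes.

(** * Finitely many cells suffice *)

Section Selection.
Variable k : closedFieldType.

Lemma perm_extend e f (g : 'I_e -> 'I_(e + f)) : injective g ->
  exists s : 'S_(e + f), forall i, s (lshift f i) = g i.
Proof.
move=> g_inj.
have card_C : #|[pred i | i \notin codom g]| = f.
  have := cardC (mem (codom g)); rewrite card_codom // !card_ord => /addnI E.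
  by rewrite -[RHS]E; apply: eq_card.
pose h (i : 'I_(e + f)) : 'I_(e + f) :=
  match split i with inl a => g a | inr b => enum_val (cast_ord (esym card_C) b) end.
have hP b : h (rshift e b) \notin codom g.
  rewrite /h; case: splitP => [a /= E|b' /= _]; first by have := ltn_ord a; rewrite -E; lia.
  by have := enum_valP (cast_ord (esym card_C) b').
have hl a : h (lshift f a) = g a by rewrite /h (unsplitK (inl a)).
have hr b : h (rshift e b) = enum_val (cast_ord (esym card_C) b) by rewrite /h (unsplitK (inr b)).
have h_inj : injective h.
  move=> i j; rewrite -[i]splitK -[j]splitK.
  case: (split i) (split j) => [a|b] [a'|b'] /=.
  - by rewrite !hl => /g_inj->.
  - by rewrite hl => E; have := hP b'; rewrite -E codom_f.
  - by rewrite hl => E; have := hP b; rewrite E codom_f.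
  - by rewrite !hr => /enum_val_inj/cast_ord_inj->.
by exists (perm h_inj) => i; rewrite permE hl.
Qed.

(** A subspace of dimension e becomes a graph after a permutation of
    coordinates, which is an isometry for the dot product. *)
Lemma perm_top_unit e f (X : 'M[k]_(e + f, e)) : row_free X^T ->
  exists s : 'S_(e + f), usubmx (row_perm s X) \in unitmx.
Proof.
move=> freeX; have fullX : row_full X by rewrite /row_full -mxrank_tr.
have [s sE] := perm_extend (@fullrankfun_inj _ _ _ _ fullX).
exists s; have := fullrowsub_unit fullX; congr (_ \in unitmx).
by apply/matrixP => i j; rewrite !mxE sE.
Qed.

(** The common solutions b of the equations indexed by the chosen s j form a
    vector space. If some x in S gives an equation that they do not all
    satisfy, adding x lowers its dimension. *)
Lemma finite_subfamily (T : Type) (S : T -> Prop) (W : finType) (a : T -> W -> k) :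
  exists (J : finType) (s : J -> T), (forall j, S (s j)) /\
    forall b : W -> k, (forall j, \sum_w a (s j) w * b w = 0) ->
    forall x, S x -> \sum_w a x w * b w = 0.
Proof.
pose v (b : W -> k) : 'rV_#|W| := \row_i b (enum_val i).
pose lin x : 'rV[k]_#|W| -> 'rV[k]_1 := mulmxr (\col_i a x (enum_val i)).
have linE x b : linfun (lin x) (v b) = 0 <-> \sum_w a x w * b w = 0.
  rewrite lfunE /=; have -> : v b *m (\col_i a x (enum_val i)) = (\sum_w a x w * b w)%:M.
    apply/matrixP => i j; rewrite !ord1 !mxE mulr1n (reindex (fun i : 'I_#|W| => enum_val i)) /=.
      by apply: eq_bigr => i' _; rewrite !mxE mulrC.
    by apply: onW_bij; exists enum_rank; [apply: enum_valK | apply: enum_rankK].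
  by split=> [/matrixP/(_ 0 0)|->]; rewrite ?raddf0 // !mxE mulr1n.
pose good (J : finType) (s : J -> T) := forall j, S (s j).
suff H d : forall (J : finType) (s : J -> T) (A : {vspace 'rV[k]_#|W|}),
    (\dim A <= d)%N -> good J s ->
    (forall b, (forall j, \sum_w a (s j) w * b w = 0) -> v b \in A) ->
    exists (J : finType) (s : J -> T), good J s /\
      forall b : W -> k, (forall j, \sum_w a (s j) w * b w = 0) ->
      forall x, S x -> \sum_w a x w * b w = 0.
  have s0 : void -> T by case.
  by apply: (H _ void s0 fullv (leqnn _)) => [[]|b _]; rewrite memvf.
elim: d => [|d IH] J s A dimA goodJ annA.
  exists J, s; split=> // b /annA; move: dimA; rewrite leqn0 dimv_eq0 => /eqP->.
  by rewrite memv0 => /eqP vb x _; apply/linE; rewrite vb linear0.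
case: (classic (exists x b, [/\ S x, v b \in A & \sum_w a x w * b w != 0])) => [[x [b [Sx bA
    xb]]]|none].
  apply: (IH (option J) (oapp s x) (A :&: lker (linfun (lin x)))%VS).
  - rewrite -ltnS; apply: leq_trans dimA; rewrite ltn_neqAle dimvS ?capvSl // andbT.
    apply: contra_neqN xb => /eqP eqdim; apply/linE.
    have : v b \in (A :&: lker (linfun (lin x)))%VS.
      have /eqP-> : (A :&: lker (linfun (lin x)) == A)%VS => //.
        by rewrite eqEdim capvSl eqdim leqnn.
    by rewrite memv_cap memv_ker => /andP[_ /eqP].
  - by case.
  - move=> b' b'0; rewrite memv_cap memv_ker annA => [|j]; last exact: (b'0 (Some j)).
    by apply/eqP/linE; apply: (b'0 None).
exists J, s; split=> // b /annA bA x Sx; apply/eqP; apply: contra_notT none => xb.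
by exists x, b.
Qed.

(** A form of the Cauchy-Binet expansion: a finite sum of products that
    separate U from X. *)
Lemma det_mul_expand l n (U : 'M[k]_(l, n)) (X : 'M_(n, l)) :
  \det (U *m X) =
  \sum_(f : {ffun 'I_l -> 'I_n}) (\prod_i U i (f i)) * \det (\matrix_(i, j) X (f i) j).
Proof.
rewrite /determinant.
rewrite (eq_bigr (fun s : 'S_l => \sum_(f : {ffun 'I_l -> 'I_n})
   (-1) ^+ s * ((\prod_i U i (f i)) * \prod_i X (f i) (s i)))); last first.
  move=> s _; rewrite -mulr_sumr; congr (_ * _).
  under eq_bigr do rewrite mxE.
  by rewrite bigA_distr_bigA; apply: eq_bigr => f _; rewrite big_split.
rewrite exchange_big; apply: eq_bigr => f _; rewrite mulr_sumr; apply: eq_bigr => s _.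
by rewrite mulrCA; congr (_ * (_ * _)); apply: eq_bigr => i _; rewrite mxE.
Qed.

(** The span of X lies in the big cell of the basis P j when a certain minor
    of X in this basis is nonzero. It lies in the cell of any hyperbolic basis
    starting with X; and since the minors, as functions of X, span a space of
    finite dimension, finitely many bases detect the vanishing of all of them. *)
Lemma finite_cells l m (F : 'M[k]_(l + (m + l))) : 2%N \notin [pchar k] ->
    F^T = F -> F \in unitmx ->
  exists (J : finType) (P : J -> 'M[k]_(l + (m + l))),
    (forall j, (P j)^T *m F *m P j = hyp_form k l m) /\
    forall X : 'M_(l + (m + l), l), row_free X^T -> X^T *m F *m X = 0 ->
      exists j, usubmx (invmx (P j) *m X) \in unitmx.
Proof.
move=> char2 symF unitF.
pose S (P : 'M[k]_(l + (m + l))) := P^T *m F *m P = hyp_form k l m.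
pose a (P : 'M[k]_(l + (m + l))) (f : {ffun 'I_l -> 'I_(l + (m + l))}) :=
  \prod_i (usubmx (invmx P)) i (f i).
have [J [P [SP H]]] := finite_subfamily S a.
exists J, P; split=> // X freeX isoX.
have [Q SQ QX] := witt_isotropic char2 symF unitF freeX isoX.
apply: NNPP => none.
have detE R : \det (usubmx (invmx R *m X)) =
    \sum_f a R f * \det (\matrix_(i, j) X (f i) j).
  by rewrite -mul_usub_mx det_mul_expand.
have := H (fun f => \det (\matrix_(i, j) X (f i) j)) _ Q SQ; rewrite -detE.
have unitQ := hyp_basis_unit SQ.
have -> : invmx Q *m X = lsubmx 1%:M by rewrite -QX mulmx_lsub mulVmx.
move=> D0.
have /D0/eqP : forall j, \sum_f a (P j) f * \det (\matrix_(i, j) X (f i) j) = 0.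
  move=> j; rewrite -detE; apply/eqP; apply: contra_notT none => dj.
  by exists j; rewrite unitmxE unitfE.
suff -> : usubmx (lsubmx (1%:M : 'M[k]_(l + (m + l)))) = 1%:M by rewrite det1 oner_eq0.
by rewrite scalar_mx_block block_mxEh row_mxKl col_mxKu.
Qed.

End Selection.

(** * Matrices of polynomial functions *)

Section PolyMx.
Variables (k : fieldType) (I : finType).

Definition polymx p q (M : (I -> k) -> 'M[k]_(p, q)) := forall i j, polyfun (fun t => M t i j).

Lemma polymx_const p q (A : 'M_(p, q)) : polymx (fun _ => A).
Proof. by move=> i j; apply: polyfun_const. Qed.

Lemma polymxD p q (A B : (I -> k) -> 'M_(p, q)) : polymx A -> polymx B -> polymx (fun t => A t
    + B t).
Proof.
by move=> pA pB i j; apply: polyfun_ext (polyfunD (pA i j) (pB i j)) => t; rewrite mxE.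
Qed.

Lemma polymxN p q (A : (I -> k) -> 'M_(p, q)) : polymx A -> polymx (fun t => - A t).
Proof. by move=> pA i j; apply: polyfun_ext (polyfunN (pA i j)) => t; rewrite mxE. Qed.

Lemma polymx_scale p q (a : (I -> k) -> k) (A : (I -> k) -> 'M_(p, q)) :
  polyfun a -> polymx A -> polymx (fun t => a t *: A t).
Proof. by move=> pa pA i j; apply: polyfun_ext (polyfunM pa (pA i j)) => t; rewrite mxE. Qed.

Lemma polymx_tr p q (A : (I -> k) -> 'M_(p, q)) : polymx A -> polymx (fun t => (A t)^T).
Proof. by move=> pA i j; apply: polyfun_ext (pA j i) => t; rewrite mxE. Qed.

Lemma polymxM p q s (A : (I -> k) -> 'M_(p, q)) (B : (I -> k) -> 'M_(q, s)) :
  polymx A -> polymx B -> polymx (fun t => A t *m B t).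
Proof.
move=> pA pB i j; apply: polyfun_ext (_ : polyfun (fun t => \sum_h A t i h * B t h j)).
  by move=> t; rewrite mxE.
by apply: polyfun_sum => h; apply: polyfunM.
Qed.

Lemma polymx_row p q s (A : (I -> k) -> 'M_(p, q)) (B : (I -> k) -> 'M_(p, s)) :
  polymx A -> polymx B -> polymx (fun t => row_mx (A t) (B t)).
Proof.
move=> pA pB i j; rewrite -[j]splitK; case: (split j) => h.
  by apply: polyfun_ext (pA i h) => t; rewrite row_mxEl.
by apply: polyfun_ext (pB i h) => t; rewrite row_mxEr.
Qed.

Lemma polymx_col p q s (A : (I -> k) -> 'M_(p, q)) (B : (I -> k) -> 'M_(s, q)) :
  polymx A -> polymx B -> polymx (fun t => col_mx (A t) (B t)).
Proof.
move=> pA pB i j; rewrite -[i]splitK; case: (split i) => h.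
  by apply: polyfun_ext (pA h j) => t; rewrite col_mxEu.
by apply: polyfun_ext (pB h j) => t; rewrite col_mxEd.
Qed.

Lemma polymx_block p q s u (A : (I -> k) -> 'M_(p, q)) (B : (I -> k) -> 'M_(p, s))
    (C : (I -> k) -> 'M_(u, q)) (D : (I -> k) -> 'M_(u, s)) :
  polymx A -> polymx B -> polymx C -> polymx D ->
  polymx (fun t => block_mx (A t) (B t) (C t) (D t)).
Proof. by move=> pA pB pC pD; apply: polymx_col; apply: polymx_row. Qed.

Lemma polymx_coord p q (g : 'I_p * 'I_q -> I) :
  polymx (fun t => \matrix_(i, j) t (g (i, j))).
Proof. by move=> i j; apply: polyfun_ext (polyfun_var k (g (i, j))) => t; rewrite mxE. Qed.

Lemma polymx_trace n (A : (I -> k) -> 'M_n) : polymx A -> polyfun (fun t => \tr (A t)).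
Proof. by move=> pA; apply: polyfun_sum. Qed.

Lemma polymx_det n (A : (I -> k) -> 'M_n) : polymx A -> polyfun (fun t => \det (A t)).
Proof.
move=> pA; apply: polyfun_sum => s; apply: polyfunM; first exact: polyfun_const.
by apply: polyfun_prod => i; apply: pA.
Qed.

End PolyMx.

Section Skew.
Variables (k : fieldType) (l : nat).

Definition skewI := {p : 'I_l * 'I_l | (p.1 < p.2)%N}.

Definition skew_mx (t : skewI -> k) : 'M[k]_l :=
  \matrix_(i, j) (oapp t 0 (insub (i, j)) - oapp t 0 (insub (j, i))).

Lemma skew_mxT t : (skew_mx t)^T = - skew_mx t.
Proof. by apply/matrixP => i j; rewrite !mxE opprB. Qed.

Lemma skew_mxE t (p : skewI) : skew_mx t (val p).1 (val p).2 = t p.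
Proof.
rewrite mxE -surjective_pairing valK /= insubF ?subr0 //=.
by apply/negbTE; rewrite -leqNgt ltnW // (valP p).
Qed.

Lemma skew_mx_surj (A : 'M[k]_l) : 2%N \notin [pchar k] -> A^T = - A ->
  A = skew_mx (fun p => A (val p).1 (val p).2).
Proof.
move=> char2 AT.
have AE i j : A j i = - A i j by have /matrixP/(_ i j) := AT; rewrite !mxE.
apply/matrixP => i j; rewrite mxE; case: (ltngtP i j) => ij.
- by rewrite insubT /= insubF ?subr0 //=; apply/negbTE; rewrite -leqNgt ltnW.
- by rewrite insubF /= ?insubT /= ?sub0r -?AE //; apply/negbTE; rewrite -leqNgt ltnW.
rewrite (val_inj ij) subrr.
have /eqP := AE j j; rewrite -addr_eq0 -mulr2n -mulr_natr mulf_eq0 => /orP[/eqP//|].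
by move=> two0; case/negP: char2; rewrite inE /=.
Qed.

Lemma card_skewI : #|{: skewI}| = 'C(l, 2).
Proof.
rewrite card_sig -bin2_sum -sum1_card big_mkord.
rewrite (eq_bigl (fun p : 'I_l * 'I_l => true && (p.1 < p.2)%N)) //.
rewrite -(pair_big_dep xpredT (fun i j : 'I_l => (i < j)%N) (fun _ _ => 1%N)) /=.
rewrite (exchange_big_dep xpredT) //=; apply: eq_bigr => j _.
rewrite sum1dep_card -[RHS](card_ord j).
have lej : (j <= l)%N by apply: ltnW.
rewrite -(card_image (f := widen_ord lej)); last by move=> a b /(congr1 val) /= /val_inj.
apply: eq_card => i; rewrite inE; apply/idP/imageP => [ij|[a _ ->]]; last exact: (ltn_ord a).
by exists (Ordinal ij) => //; apply: val_inj.
Qed.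

End Skew.

(** * The chart around an isotropic subspace *)

Section Coords.
Variables (k : fieldType) (n r : nat).

Definition coords_of (A : 'I_r -> 'M[k]_n) : 'rV[k]_(r * (n * n)) :=
  mxvec (\matrix_i mxvec (A i)).

Lemma polyfun_coords (I : finType) (M : 'I_r -> (I -> k) -> 'M[k]_n) :
  (forall i, polymx (M i)) -> forall j, polyfun (fun t => coords_of (fun i => M i t) ord0 j).
Proof.
move=> pM j; case/mxvec_indexP: j => i j; case/mxvec_indexP: j => a b.
by apply: polyfun_ext (pM i a b) => t; rewrite /coords_of mxvecE mxE mxvecE.
Qed.
End Coords.

Lemma tuple_of_coordsE (k : closedFieldType) n r (B : 'I_r -> 'M[k]_n) i :
  tuple_of_coords (coords_of B) i = B i.
Proof. by rewrite /tuple_of_coords mxvecK rowK mxvecK. Qed.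

Lemma coords_ofK (k : closedFieldType) n r (x : 'rV[k]_(r * (n * n))) :
  coords_of (tuple_of_coords x) = x.
Proof.
rewrite /coords_of -[RHS]vec_mxK; congr mxvec.
by apply/row_matrixP => i; rewrite rowK vec_mxK.
Qed.

Section EntryPoly.
Variables (k : closedFieldType) (n r : nat).

Lemma entry_poly (P Q : 'M[k]_n) (i : 'I_r) a b : exists p : {mpoly k[r * (n * n)]},
  forall A, ev p (coords_of A) = (Q *m A i *m P) a b.
Proof.
exists (\sum_b' \sum_a' (Q a a' * P b' b) *: 'X_(mxvec_index i (mxvec_index a' b'))) => A.
rewrite /ev raddf_sum mxE /=; apply: eq_bigr => b' _.
rewrite raddf_sum mxE big_distrl /=; apply: eq_bigr => a' _.
by rewrite mevalZ mevalXU /coords_of mxvecE mxE mxvecE mulrAC.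
Qed.

End EntryPoly.

Section Chart.
Variable k : closedFieldType.
Hypothesis char2 : 2%N \notin [pchar k].
Variables (l m r : nat) (G H : finType) (mid : (G -> k) -> (H -> k) -> 'M[k]_m).
Hypothesis mid_ext : forall a a' b b', a =1 a' -> b =1 b' -> mid a b = mid a' b'.
Hypothesis poly_mid : forall (K : finType) (g : G -> K) (h : H -> K),
  polymx (fun t : K -> k => mid (fun x => t (g x)) (fun x => t (h x))).

Definition mxI p q : finType := ('I_p * 'I_q)%type.
(** The coordinates of one matrix: the blocks a, x, c of ut_mx, the parameters
    H of its block C, and the blocks y, b. *)
Definition blockI : finType :=
  ((mxI l l + mxI l m + mxI l l) + H + (mxI m l + mxI l l))%type.
(** The graph (Y, Z) of L is shared by the r matrices, and so are the
    parameters G, which describe a subspace of U. *)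
Definition chartI : finType := (mxI m l + skewI l + G + 'I_r * blockI)%type.

Lemma card_chartI :
  #|chartI| = (m * l + 'C(l, 2) + #|G| + r * (3 * (l * l) + 2 * (l * m) + #|H|))%N.
Proof.
rewrite !(card_sum, card_prod) card_skewI !card_ord; clear; lia.
Qed.

Implicit Type t : chartI -> k.

Definition cY t : 'M_(m, l) := \matrix_(i, j) t (inl (inl (inl (i, j)))).
Definition cS t : 'M_l := skew_mx (fun p => t (inl (inl (inr p)))).
Definition cG t : G -> k := fun g => t (inl (inr g)).
Definition ca t i : 'M_l := \matrix_(a, b) t (inr (i, inl (inl (inl (inl (a, b)))))).
Definition cx t i : 'M_(l, m) := \matrix_(a, b) t (inr (i, inl (inl (inl (inr (a, b)))))).
Definition cc t i : 'M_l := \matrix_(a, b) t (inr (i, inl (inl (inr (a, b))))).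
Definition cH t i : H -> k := fun h => t (inr (i, inl (inr h))).
Definition cy t i : 'M_(m, l) := \matrix_(a, b) t (inr (i, inr (inl (a, b)))).
Definition cb t i : 'M_l := \matrix_(a, b) t (inr (i, inr (inr (a, b)))).

(** Isotropy determines the symmetric part of Z; the skew part is free. *)
Definition cZ t := cS t - 2%:R^-1 *: ((cY t)^T *m cY t).

(** The r matrices preserve one isotropic subspace, parametrized as a graph,
    and its orthogonal. The family mid of middle blocks is arbitrary because
    covering a stratum requires matrices that stabilize a subspace of U, and
    building chains all matrices. *)
Definition chart t i :=
  unip_mx (cY t) (cZ t) *m
  ut_mx (ca t i) (cx t i) (cc t i) (mid (cG t) (cH t i)) (cy t i) (cb t i) *m
  unip_inv (cY t) (cZ t).

Lemma half_half (V : lmodType k) (v : V) : 2%:R^-1 *: v + 2%:R^-1 *: v = v.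
Proof.
rewrite -scalerDl -[RHS]scale1r; congr (_ *: _); field.
by apply: two_neq0.
Qed.

Lemma chart_isotropic_graph t : isotropic_graph (cY t) (cZ t).
Proof.
rewrite /isotropic_graph /cZ trmxD trmxN trmxZ trmx_mul trmxK skew_mxT.
rewrite addrACA subrr add0r -opprD half_half.
by rewrite addNr.
Qed.

Lemma polymx_chart i : polymx (fun t => chart t i).
Proof.
have pY : polymx cY by apply: polymx_coord (fun p => inl (inl (inl p))).
have pS : polymx cS.
  move=> a b; apply: polyfun_ext (_ : polyfun (fun t => oapp (fun p => t (inl (inl (inr p)))) 0
      (insub (a, b)) - oapp (fun p => t (inl (inl (inr p)))) 0 (insub (b, a)))).
    by move=> t; rewrite mxE.
  have pS (o : option (skewI l)) : polyfun (fun t => oapp (fun p => t (inl (inl (inr p)))) 0 o).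
    by case: o => [p|]; [apply: polyfun_var | apply: polyfun_const].
  by apply: polyfunD; [apply: pS | apply: polyfunN; apply: pS].
have pZ : polymx cZ.
  apply: polymxD pS (polymxN (polymx_scale (polyfun_const _ _) _)).
  by apply: polymxM => //; apply: polymx_tr.
apply: polymxM; [apply: polymxM|].
- do ?[apply: polymx_block | apply: polymx_const | apply: polymx_col] => //.
  by apply: polymxN; apply: polymx_tr.
- do ?[apply: polymx_block | apply: polymx_const | apply: polymx_row].
  + exact: (@polymx_coord k chartI _ _ (fun p => inr (i, inl (inl (inl (inl p)))))).
  + exact: (@polymx_coord k chartI _ _ (fun p => inr (i, inl (inl (inl (inr p)))))).
  + exact: (@polymx_coord k chartI _ _ (fun p => inr (i, inl (inl (inr p))))).
  + exact: (@poly_mid chartI (fun g => inl (inr g)) (fun h => inr (i, inl (inr h)))).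
  + exact: (@polymx_coord k chartI _ _ (fun p => inr (i, inr (inl p)))).
  + exact: (@polymx_coord k chartI _ _ (fun p => inr (i, inr (inr p)))).
- do ?[apply: polymx_block | apply: polymx_const | apply: polymx_col] => //.
  + exact: polymxN.
  + exact: polymx_tr.
  + exact: polymx_tr.
Qed.

Lemma chart_surj Y Z (a : 'I_r -> 'M_l) (x : 'I_r -> 'M_(l, m)) (c : 'I_r -> 'M_l)
    (y : 'I_r -> 'M_(m, l)) (b : 'I_r -> 'M_l) (tG : G -> k) (tH : 'I_r -> H -> k) :
  isotropic_graph Y Z -> exists t, forall i, chart t i =
    unip_mx Y Z *m ut_mx (a i) (x i) (c i) (mid tG (tH i)) (y i) (b i) *m unip_inv Y Z.
Proof.
move=> iso.
pose S := Z + 2%:R^-1 *: (Y^T *m Y).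
have ST : S^T = - S.
  rewrite /S trmxD trmxZ trmx_mul trmxK; apply/eqP; rewrite -addr_eq0 addrACA half_half.
  by rewrite [Z^T + Z]addrC iso.
exists (fun p => match p with
  | inl (inl (inl p)) => Y p.1 p.2
  | inl (inl (inr p)) => S (val p).1 (val p).2
  | inl (inr g) => tG g
  | inr (i, inl (inl (inl (inl p)))) => a i p.1 p.2
  | inr (i, inl (inl (inl (inr p)))) => x i p.1 p.2
  | inr (i, inl (inl (inr p))) => c i p.1 p.2
  | inr (i, inl (inr h)) => tH i h
  | inr (i, inr (inl p)) => y i p.1 p.2
  | inr (i, inr (inr p)) => b i p.1 p.2
  end) => i.
rewrite /chart; set t := (X in cY X).
have -> : cY t = Y by apply/matrixP => u v; rewrite mxE.
have -> : cZ t = Z.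
  rewrite /cZ; have -> : cY t = Y by apply/matrixP => u v; rewrite mxE.
  by rewrite /cS -(skew_mx_surj char2 ST) /S addrK.
have -> : ca t i = a i by apply/matrixP => u v; rewrite mxE.
have -> : cx t i = x i by apply/matrixP => u v; rewrite mxE.
have -> : cc t i = c i by apply/matrixP => u v; rewrite mxE.
have -> : cy t i = y i by apply/matrixP => u v; rewrite mxE.
have -> : cb t i = b i by apply/matrixP => u v; rewrite mxE.
by rewrite (mid_ext (a' := tG) (b' := tH i)).
Qed.

End Chart.

(** * Matrices stabilizing a nondegenerate subspace and its orthogonal *)

Section Middle.
Variable k : closedFieldType.
Variables e f : nat.

Definition midG : finType := mxI f e.
Definition midH : finType := (mxI e e + mxI f f)%type.

(** The coordinates g describe a graph in U, up to the permutation s, and h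
    the action on it and on its orthogonal. *)
Definition mid_stable (s : 'S_(e + f)) (g : midG -> k) (h : midH -> k) : 'M_(e + f) :=
  let Q := orth_mx (\matrix_(i, j) g (i, j)) in
  (perm_mx s)^T *m
  (Q *m block_mx (\matrix_(i, j) h (inl (i, j))) 0 0 (\matrix_(i, j) h (inr (i, j))) *m Q^T) *m
  perm_mx s.

Lemma mid_stable_ext s a a' b b' : a =1 a' -> b =1 b' -> mid_stable s a b = mid_stable s a' b'.
Proof.
move=> aa bb; rewrite /mid_stable.
have -> : \matrix_(i < f, j < e) a (i, j) = \matrix_(i, j) a' (i, j).
  by apply/matrixP => i j; rewrite !mxE aa.
have -> : \matrix_(i < e, j < e) b (inl (i, j)) = \matrix_(i, j) b' (inl (i, j)).
  by apply/matrixP => i j; rewrite !mxE bb.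
have -> : \matrix_(i < f, j < f) b (inr (i, j)) = \matrix_(i, j) b' (inr (i, j)) => //.
by apply/matrixP => i j; rewrite !mxE bb.
Qed.

Lemma polymx_mid_stable s (K : finType) (g : midG -> K) (h : midH -> K) :
  polymx (fun t : K -> k => mid_stable s (fun x => t (g x)) (fun x => t (h x))).
Proof.
have pQ : polymx (fun t : K -> k => orth_mx (\matrix_(i, j) t (g (i, j)))).
  apply: polymx_block; try exact: polymx_const.
    exact/polymxN/polymx_tr/(@polymx_coord k K _ _ g).
  exact: (@polymx_coord k K _ _ g).
apply: polymxM; last exact: polymx_const.
apply: polymxM; first exact: polymx_const.
apply: polymxM; last exact: polymx_tr.
apply: polymxM => //.
apply: polymx_block; try exact: polymx_const.
  exact: (@polymx_coord k K _ _ (fun p => h (inl p))).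
exact: (@polymx_coord k K _ _ (fun p => h (inr p))).
Qed.

Lemma perm_mx_tr_mul (s : 'S_(e + f)) : (perm_mx s)^T *m perm_mx s = 1%:M :> 'M[k]_(e + f).
Proof. by rewrite tr_perm_mx -perm_mxM mulVg perm_mx1. Qed.

Lemma mid_stable_surj (T : finType) (C : T -> 'M[k]_(e + f)) (X : 'M_(e + f, e)) :
    X^T *m X \in unitmx ->
    (forall i, exists R, C i *m X = X *m R) ->
    (forall i, exists R, (C i)^T *m X = X *m R) ->
  exists s tG tH, forall i, C i = mid_stable s tG (tH i).
Proof.
move=> unitX CX CTX.
have freeX : row_free X^T.
  by rewrite -row_leq_rank; apply: leq_trans (mxrankM_maxl _ X); rewrite mxrank_unit.
have [s unitU] := perm_top_unit freeX.
pose S : 'M[k]_(e + f) := perm_mx s.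
have STS : S^T *m S = 1%:M by apply: perm_mx_tr_mul.
have SST : S *m S^T = 1%:M by apply: mulmx1C.
set U := usubmx _ in unitU.
pose Y := dsubmx (S *m X) *m invmx U.
pose X' := col_mx 1%:M Y : 'M_(e + f, e).
have X'E : X' = S *m X *m invmx U.
  rewrite -[S *m X]vsubmxK mul_col_mx -row_permE -/U mulmxV //.
  by rewrite /X' /Y -row_permE.
have XE : S^T *m X' *m U = X by rewrite X'E !mulmxA STS mul1mx mulmxKV.
have unitX' : X'^T *m X' \in unitmx.
  rewrite X'E !trmx_mul -!mulmxA [S^T *m _]mulmxA STS mul1mx [X^T *m _]mulmxA.
  by rewrite !unitmx_mul unitmx_tr unitmx_inv unitU unitX.
have conj (B : 'M_(e + f)) R : B *m X = X *m R ->
    S *m B *m S^T *m X' = X' *m (U *m R *m invmx U).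
  move=> BX; rewrite {1}X'E -!mulmxA [S^T *m _]mulmxA STS mul1mx [B *m _]mulmxA BX.
  by rewrite X'E -!mulmxA mulKmx.
have [D DE] : exists D : T -> 'M_e * 'M_f, forall i,
    S *m C i *m S^T = orth_mx Y *m block_mx (D i).1 0 0 (D i).2 *m (orth_mx Y)^T.
  apply: (@fin_all_exists _ (fun _ => ('M_e * 'M_f)%type) (fun i D =>
     S *m C i *m S^T = orth_mx Y *m block_mx D.1 0 0 D.2 *m (orth_mx Y)^T)) => i.
  have [[R RE] [R' R'E]] := (CX i, CTX i).
  have [||//|D1 [D2 DE]] := @stable_graph_shape k e f Y (S *m C i *m S^T) (U *m R *m invmx U)
      (U *m R' *m invmx U).
  - exact: conj.
  - by rewrite !trmx_mul trmxK mulmxA; apply: conj.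
  by exists (D1, D2).
exists s, (fun p => Y p.1 p.2), (fun i p => match p with
  inl p => (D i).1 p.1 p.2 | inr p => (D i).2 p.1 p.2 end) => i.
rewrite /mid_stable.
have -> : \matrix_(i, j) Y (i, j).1 (i, j).2 = Y by apply/matrixP => u v; rewrite mxE.
have -> : \matrix_(u, v) (D i).1 (u, v).1 (u, v).2 = (D i).1 by apply/matrixP => u v; rewrite mxE.
have -> : \matrix_(u, v) (D i).2 (u, v).1 (u, v).2 = (D i).2 by apply/matrixP => u v; rewrite mxE.
by rewrite -DE -/S !mulmxA STS mul1mx -mulmxA STS mulmx1.
Qed.

End Middle.

(** * The charts cover a stratum *)

Lemma gram_change_basis (k : fieldType) n p q (F F0 P : 'M[k]_n) (M : 'M_(n, p)) (M' : 'M_(n,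
    q)) :
  P \in unitmx -> P^T *m F *m P = F0 ->
  (invmx P *m M)^T *m F0 *m (invmx P *m M') = M^T *m F *m M'.
Proof.
move=> unitP <-; rewrite -{2}[M](mulKVmx unitP) -{2}[M'](mulKVmx unitP).
by rewrite [in RHS]trmx_mul !mulmxA.
Qed.

Lemma hyp_form_col (k : closedFieldType) l m p (a c : 'M[k]_(l, p)) (b : 'M_(m, p)) :
  hyp_form k l m *m col_mx a (col_mx b c) = col_mx c (col_mx b a).
Proof.
rewrite /hyp_form mul_block_col mul_row_col mul_col_mx mul_block_col.
by rewrite !mul0mx !mul1mx !(add0r, addr0) add_col_mx add0r addr0.
Qed.

Lemma hyp_form_gram (k : closedFieldType) l m p q (a c : 'M[k]_(l, p)) (b : 'M_(m, p))
    (a' c' : 'M[k]_(l, q)) (b' : 'M_(m, q)) :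
  (col_mx a (col_mx b c))^T *m hyp_form k l m *m col_mx a' (col_mx b' c') =
  a^T *m c' + (b^T *m b' + c^T *m a').
Proof. by rewrite -mulmxA hyp_form_col !tr_col_mx !mul_row_col. Qed.

Lemma lsubmx1E (k : fieldType) l m : lsubmx (1%:M : 'M[k]_(l + m)) = col_mx 1%:M 0.
Proof. by rewrite scalar_mx_block block_mxEh row_mxKl. Qed.

Section Cover.
Variable k : closedFieldType.
Hypothesis char2 : 2%N \notin [pchar k].
Variables (l e f r : nat).
Local Notation m := (e + f)%N.
Local Notation n := (l + (m + l))%N.
Variable F : 'M[k]_n.
Hypothesis (symF : F^T = F) (unitF : F \in unitmx).

Local Notation chartE s t i := (@chart k l m r (midG e f) (midH e f) (mid_stable s) t i).

(** X1 spans the radical of W and X2 a complement of it in W. The basis h is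
    the image of P under the isometry that moves the standard isotropic
    subspace to the span of X1. In it the matrices are block triangular, and
    the middle component V of X2 spans a nondegenerate subspace stable under
    the middle blocks and their transposes. *)
Lemma cover_by_chart (P : 'M[k]_n) (A As : 'I_r -> 'M[k]_n) (X1 : 'M_(n, l)) (X2 : 'M_(n, e)) :
    P^T *m F *m P = hyp_form k l m -> usubmx (invmx P *m X1) \in unitmx ->
    (forall i, (As i)^T *m F = F *m A i) ->
    X1^T *m F *m X1 = 0 -> X1^T *m F *m X2 = 0 -> X2^T *m F *m X2 \in unitmx ->
    (forall i, exists R, A i *m X1 = X1 *m R) -> (forall i, exists R, As i *m X1 = X1 *m R) ->
    (forall i, exists S R, A i *m X2 = X1 *m S + X2 *m R) ->
    (forall i, exists S R, As i *m X2 = X1 *m S + X2 *m R) ->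
  exists s t, forall i, A i = P *m chartE s t i *m invmx P.
Proof.
move=> PF unitU adj X1F X12 X2F AX1 AsX1 AX2 AsX2.
set U := usubmx _ in unitU; have unitP := hyp_basis_unit PF.
pose N := X1 *m invmx U.
have NE : invmx P *m N = col_mx 1%:M (dsubmx (invmx P *m N)).
  rewrite -[LHS]vsubmxK; congr (col_mx _ _).
  by rewrite mulmxA -mul_usub_mx -/U mulmxV.
pose Y := usubmx (dsubmx (invmx P *m N)); pose Z := dsubmx (dsubmx (invmx P *m N)).
have {}NE : invmx P *m N = col_mx 1%:M (col_mx Y Z) by rewrite NE vsubmxK.
have NF : N^T *m F *m N = 0.
  by rewrite trmx_mul -!mulmxA [F *m (X1 *m _)]mulmxA [X1^T *m _]mulmxA [X1^T *m (F *m
      X1)]mulmxA X1F mul0mx mulmx0.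
have iso : isotropic_graph Y Z.
  have := gram_change_basis N N unitP PF; rewrite NF.
  rewrite NE hyp_form_gram trmx1 mul1mx mulmx1 => iso.
  by rewrite /isotropic_graph -addrA [Z^T + _]addrC.
pose h := P *m unip_mx Y Z.
have hN : lsubmx h = N.
  by rewrite /h -mulmx_lsub lsubmx_unip_mx -NE mulKVmx.
have hF : h^T *m F *m h = hyp_form k l m.
  by rewrite trmx_mul -(unip_mx_form iso) -PF !mulmxA.
have unith := hyp_basis_unit hF.
pose W := invmx h *m X2; pose V := usubmx (dsubmx W).
have X2E : X2 = h *m W by rewrite mulKVmx.
have WE0 : W = col_mx (usubmx W) (col_mx V (dsubmx (dsubmx W))) by rewrite !vsubmxK.
have W3 : dsubmx (dsubmx W) = 0.
  have NX2 : N^T *m F *m X2 = 0.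
    by rewrite trmx_mul -!mulmxA [X1^T *m _]mulmxA X12 mulmx0.
  have := gram_change_basis N X2 unith hF; rewrite NX2.
  rewrite -/W WE0 -hN mulmx_lsub mulVmx // lsubmx1E.
  rewrite -col_mx0 hyp_form_gram trmx1 mul1mx !trmx0 !mul0mx !addr0.
  by rewrite !col_mxKd.
have WE : W = col_mx (usubmx W) (col_mx V 0) by rewrite -W3.
have unitV : V^T *m V \in unitmx.
  have := gram_change_basis X2 X2 unith hF.
  rewrite -/W WE hyp_form_gram mulmx0 trmx0 mul0mx addr0 add0r => ->; exact: X2F.
have hE : h = P *m unip_mx Y Z by [].
clearbody h W.
have shape i : exists R x c C y R', [/\ A i *m h = h *m ut_mx R x c C y R',
     As i *m h = h *m ut_mx R'^T y^T c^T C^T x^T R^T &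
     (exists T, C *m V = V *m T) /\ (exists T, C^T *m V = V *m T)].
  have [[R0 AR] [R0' AsR]] := (AX1 i, AsX1 i).
  have AN : A i *m lsubmx h = lsubmx h *m (U *m R0 *m invmx U).
    by rewrite hN /N mulmxA AR -!mulmxA mulKmx.
  have AsN : As i *m lsubmx h = lsubmx h *m (U *m R0' *m invmx U).
    by rewrite hN /N mulmxA AsR -!mulmxA mulKmx.
  have [x [c [C [y [hA hAs]]]]] := adapted_shape hF (adj i) AN AsN.
  exists (U *m R0 *m invmx U), x, c, C, y, (U *m R0' *m invmx U)^T.
  rewrite trmxK; split=> //.
  have mid (B : 'M_n) a x' c' C' y' b : B *m h = h *m ut_mx a x' c' C' y' b ->
      (exists S R, B *m X2 = X1 *m S + X2 *m R) -> exists T, C' *m V = V *m T.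
    move=> Bh [S [T BX]]; exists T.
    have X1E : X1 = h *m (lsubmx 1%:M *m U).
      by rewrite mulmxA mulmx_lsub mulmx1 hN /N mulmxKV.
    move: BX; rewrite X2E mulmxA Bh X1E -!mulmxA -mulmxDr => /(congr1 (mulmx (invmx h))).
    rewrite !mulKmx //.
    rewrite lsubmx1E WE /ut_mx mul_block_col mul_block_col !mul_col_mx add_col_mx.
    move/eq_col_mx => [_]; rewrite !(mul0mx, mulmx0, add0r, addr0).
    by move/eq_col_mx => [].
  by split; [apply: mid hA (AX2 i) | apply: mid hAs (AsX2 i)].
have [a /fin_all_exists[x /fin_all_exists[c /fin_all_exists[C /fin_all_exists[y
    /fin_all_exists[b H]]]]]] :=
  fin_all_exists shape.
have [s [tG [tH CE]]] := @mid_stable_surj k e f _ C V unitV (fun i => let: And3 _ _ H := H i in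
    H.1)
   (fun i => let: And3 _ _ H := H i in H.2).
have [t tE] := chart_surj char2 (@mid_stable_ext k e f s) a x c y b tG tH iso.
exists s, t => i; have [hA _ _] := H i.
rewrite tE -CE -!mulmxA.
have -> : unip_inv Y Z *m invmx P = invmx h.
  apply: (can_inj (mulKmx unith)); rewrite mulmxV // hE -mulmxA [unip_mx Y Z *m _]mulmxA.
  by rewrite unip_mxV // mul1mx mulmxV.
by rewrite !mulmxA -hE -hA mulmxK.
Qed.
End Cover.

(** * From subspaces to matrices *)

Section Subspaces.
Variables (k : fieldType) (n : nat).

Definition spans_by d (U : {vspace 'cV[k]_n}) (X : 'M_(n, d)) :=
  forall w, w \in U <-> exists y, w = X *m y.

Lemma vspace_basis_mx (U : {vspace 'cV[k]_n}) d : \dim U = d ->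
  exists2 X : 'M_(n, d), spans_by U X & row_free X^T.
Proof.
move=> <-; pose X := \matrix_(i < n, j < \dim U) (vbasis U)`_j i 0.
have XE (y : 'cV_(\dim U)) : X *m y = \sum_j y j 0 *: (vbasis U)`_j.
  apply/matrixP => i j; rewrite !ord1 mxE summxE; apply: eq_bigr => h _.
  by rewrite !mxE mulrC.
exists X => [w|]; first split.
- move=> /coord_vbasis ->; exists (\col_j coord (vbasis U) j w); rewrite XE.
  by apply: eq_bigr => j _; rewrite mxE.
- move=> [y ->]; rewrite XE; apply: memv_suml => j _; apply: memvZ.
  by apply: vbasis_mem; rewrite mem_nth // size_tuple.
rewrite -kermx_eq0; apply/rowV0P => u /sub_kermxP uX.
have /freeP/(_ (fun j => u 0 j)) := basis_free (vbasisP U).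
move=> H; apply/rowP => j; rewrite mxE; apply: H.
have := XE u^T; rewrite -[X]trmxK -trmx_mul uX trmx0 => /esym E.
by rewrite -[RHS]E; apply: eq_bigr => h _; rewrite mxE.
Qed.

Lemma vspace_of_mx d (X : 'M[k]_(n, d)) : row_free X^T ->
  exists2 U : {vspace 'cV[k]_n}, spans_by U X & \dim U = d.
Proof.
move=> freeX; pose f := linfun (mulmx X : 'cV[k]_d -> 'cV_n).
have fE y : f y = X *m y by rewrite lfunE.
exists (f @: fullv)%VS => [w|].
  split=> [/memv_imgP[y _ ->]|[y ->]]; first by exists y.
  by rewrite -fE memv_img ?memvf.
rewrite limg_dim_eq ?dimvf /dim /= ?muln1 //.
apply/eqP; rewrite -subv0; apply/subvP => y; rewrite memv_cap memv_ker fE memv0 => /andP[_ /eqP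
    Xy].
apply/eqP/trmx_inj/(row_free_inj freeX).
by rewrite trmx0 mul0mx -trmx_mul Xy trmx0.
Qed.

Lemma mulmx_lift p d (X : 'M[k]_(n, d)) (M : 'M_(n, p)) :
  (forall j, exists y, col j M = X *m y) -> exists R, M = X *m R.
Proof.
move=> /fin_all_exists[y yE]; exists (\matrix_(i, j) y j i 0).
apply/matrixP => i j; have /matrixP/(_ i 0) := yE j; rewrite !mxE => ->.
by apply: eq_bigr => h _; rewrite !mxE.
Qed.

Lemma col_spans d (U : {vspace 'cV[k]_n}) (X : 'M_(n, d)) j : spans_by U X -> col j X \in U.
Proof. by move=> XU; apply/XU; exists (delta_mx j 0); rewrite -colE. Qed.

End Subspaces.

Section FormMatrix.
Variables (k : closedFieldType) (n : nat) (form : {symmetric 'cV[k]_n}).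

Definition gram : 'M[k]_n := \matrix_(i, j) form (delta_mx i 0) (delta_mx j 0).

Lemma formE v w : form v w = (v^T *m gram *m w) 0 0.
Proof.
have cvE (u : 'cV[k]_n) : u = \sum_i u i 0 *: delta_mx i 0.
  rewrite {1}[u]matrix_sum_delta; apply: eq_bigr => i _.
  by rewrite big_ord1.
rewrite {1}[v]cvE {1}[w]cvE linear_sumr mxE; apply: eq_bigr => j _.
rewrite linear_sumlz mxE mulr_suml; apply: eq_bigr => i _.
by rewrite linearZl_LR linearZr_LR /= !mxE mulrA mulrAC.
Qed.

Lemma form_sym v w : form v w = form w v.
Proof. by rewrite hermC expr0 mul1r. Qed.

Lemma gram_sym : gram^T = gram.
Proof. by apply/matrixP => i j; rewrite !mxE form_sym. Qed.

Lemma form_mulmx p q (X : 'M_(n, p)) (X' : 'M_(n, q)) y z :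
  form (X *m y) (X' *m z) = (y^T *m (X^T *m gram *m X') *m z) 0 0.
Proof. by rewrite formE trmx_mul !mulmxA. Qed.

Lemma mx_form_eq0 p q (M : 'M[k]_(p, q)) :
  (forall (y : 'cV_p) (z : 'cV_q), (y^T *m M *m z) 0 0 = 0) -> M = 0.
Proof.
move=> M0; apply/matrixP => i j; have := M0 (delta_mx i 0) (delta_mx j 0).
by rewrite trmx_delta -rowE -colE !mxE.
Qed.

Hypothesis form_nondeg : nondegenerate form.

Lemma gram_unit : gram \in unitmx.
Proof.
rewrite -row_free_unit -kermx_eq0; apply/rowV0P => u /sub_kermxP uF.
have : u^T \in orthov form fullv.
  by apply/mem_orthovP => v _; rewrite formE trmxK uF mul0mx mxE.
move/eqP: form_nondeg => ->; rewrite memv0 => /eqP/(congr1 trmx).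
by rewrite trmxK trmx0.
Qed.

Variables (rho : 'M[k]_n -> 'M[k]_n).
Hypothesis rho_adjoint : is_adjoint form rho.

Lemma adjoint_gram A : (rho A)^T *m gram = gram *m A.
Proof.
apply/eqP; rewrite -subr_eq0; apply/eqP; apply: mx_form_eq0 => y z.
rewrite mulmxBr mulmxBl mxE [X in _ + X]mxE; apply/eqP; rewrite subr_eq0; apply/eqP.
have := rho_adjoint A y z; rewrite !formE trmx_mul => E.
by rewrite !mulmxA in E *.
Qed.

(** X1 spans the radical of W, which is stable because its vectors are those
    of W orthogonal to W. A vector in the span of X2 orthogonal to this span
    is orthogonal to all of W, hence zero; so X2 has an invertible Gram
    matrix. *)
Lemma adapted_data r l e (A : 'I_r -> 'M[k]_n) (W : {vspace 'cV[k]_n}) :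
    rho_invariant rho A W -> \dim W = (l + e)%N -> isotropy_rank form W = l ->
  exists X1 : 'M_(n, l), exists X2 : 'M_(n, e),
    [/\ row_free X1^T, X1^T *m gram *m X1 = 0, X1^T *m gram *m X2 = 0
      & X2^T *m gram *m X2 \in unitmx] /\
    [/\ forall i, exists R, A i *m X1 = X1 *m R,
        forall i, exists R, rho (A i) *m X1 = X1 *m R,
        forall i, exists S R, A i *m X2 = X1 *m S + X2 *m R &
        forall i, exists S R, rho (A i) *m X2 = X1 *m S + X2 *m R].
Proof.
move=> inv dimW; rewrite /isotropy_rank; set L := (W :&: _)%VS => dimL.
pose C := (W :\: orthov form W)%VS.
have dimC : \dim C = e by have := dimv_cap_compl W (orthov form W); rewrite dimL dimW => /addnI.
have [X1 X1L free1] := vspace_basis_mx dimL.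
have [X2 X2C free2] := vspace_basis_mx dimC.
have LW w : w \in L -> w \in W by apply/subvP/capvSl.
have CW w : w \in C -> w \in W by apply/subvP/diffvSl.
have LP w : w \in L -> forall v, v \in W -> form w v = 0.
  by rewrite memv_cap => /andP[_ /mem_orthovP].
have splitW w : w \in W -> exists y z, w = X1 *m y + X2 *m z.
  rewrite -(addv_diff_cap W (orthov form W)) => /memv_addP[v /X2C[z ->] [u /X1L[y ->] ->]].
  by exists y, z; rewrite addrC.
exists X1, X2; split; split=> //.
- apply: mx_form_eq0 => y z; rewrite -form_mulmx; apply: LP; first by apply/X1L; exists y.
  by apply/LW/X1L; exists z.
- apply: mx_form_eq0 => y z; rewrite -form_mulmx; apply: LP; first by apply/X1L; exists y.
  by apply/CW/X2C; exists z.
- rewrite -row_free_unit -kermx_eq0; apply/rowV0P => u /sub_kermxP uF.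
  pose w := X2 *m u^T.
  have wC : w \in C by apply/X2C; exists u^T.
  have wL : w \in L.
    rewrite memv_cap CW //; apply/mem_orthovP => v /splitW[y [z ->]].
    have wz : form w (X2 *m z) = 0 by rewrite form_mulmx trmxK uF mul0mx mxE.
    rewrite linearDr /= wz addr0 form_sym; apply: LP.
      by apply/X1L; exists y.
    exact: CW.
  have : w \in (C :&: orthov form W)%VS.
    by rewrite memv_cap wC; move: wL; rewrite memv_cap => /andP[].
  rewrite capv_diff memv0 => /eqP w0.
  by apply: (row_free_inj free2); rewrite mul0mx -[u]trmxK -trmx_mul -/w w0 trmx0.
- move=> i; apply: mulmx_lift => j; rewrite colE -mulmxA -colE; apply/X1L.
  have [AW rAW] := inv i; have jL := col_spans j X1L.
  rewrite memv_cap AW ?LW //; apply/mem_orthovP => v vW.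
  by rewrite form_sym -rho_adjoint form_sym; apply: LP => //; apply: rAW.
- move=> i; apply: mulmx_lift => j; rewrite colE -mulmxA -colE; apply/X1L.
  have [AW rAW] := inv i; have jL := col_spans j X1L.
  rewrite memv_cap rAW ?LW //; apply/mem_orthovP => v vW.
  by rewrite rho_adjoint; apply: LP => //; apply: AW.
- move=> i; suff [R ->] : exists R, A i *m X2 = row_mx X1 X2 *m R.
    by exists (usubmx R), (dsubmx R); rewrite -mul_row_col vsubmxK.
  apply: mulmx_lift => j; rewrite colE -mulmxA -colE.
  have /splitW[y [z ->]] := (inv i).1 _ (CW _ (col_spans j X2C)).
  by exists (col_mx y z); rewrite mul_row_col.
- move=> i; suff [R ->] : exists R, rho (A i) *m X2 = row_mx X1 X2 *m R.
    by exists (usubmx R), (dsubmx R); rewrite -mul_row_col vsubmxK.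
  apply: mulmx_lift => j; rewrite colE -mulmxA -colE.
  have /splitW[y [z ->]] := (inv i).2 _ (CW _ (col_spans j X2C)).
  by exists (col_mx y z); rewrite mul_row_col.
Qed.

End FormMatrix.

(** * Upper bound for the dimension of a stratum *)

(** For W of dimension l + e and isotropy rank l in a space of dimension 2 l +
    e + f: the radical L depends on l (e + f) + l (l - 1) / 2 parameters, W /
    L inside the orthogonal of L modulo L on e f, and each matrix preserving W
    and its orthogonal on the remaining summand. *)
Definition stratum_dim (r l e f : nat) : nat :=
  (e + f) * l + 'C(l, 2) + f * e + r * (3 * (l * l) + 2 * (l * (e + f)) + (e * e + f * f)).

Section Upper.
Variables (k : closedFieldType) (n r : nat) (form : {symmetric 'cV[k]_n}).
Variable rho : 'M[k]_n -> 'M[k]_n.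
Hypothesis (char2 : 2%N \notin [pchar k]) (form_nondeg : nondegenerate form).
Hypothesis rho_adjoint : is_adjoint form rho.

(** The charts are indexed by a hyperbolic basis of the whole space and a
    permutation of the coordinates of U. *)
Lemma Zvar_chain_le l e f m : n = (l + ((e + f) + l))%N ->
  has_irreducible_chain (@Zvar k n r form rho l (l + e)) m ->
  (m <= stratum_dim r l e f)%N.
Proof.
move=> En chain; subst n.
have [J [P [PF cells]]] := finite_cells char2 (gram_sym form) (gram_unit form_nondeg).
pose Phi (c : J * 'S_(e + f)) (t : chartI l (e + f) r (midG e f) (midH e f) -> k) :=
  coords_of (fun i => P c.1 *m chart (mid_stable c.2) t i *m invmx (P c.1)).
have := chain_le_params (Phi := Phi) _ _ chain.
rewrite card_chartI !(card_sum, card_prod) !card_ord; apply.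
- move=> c i; apply: polyfun_coords => j.
  apply: polymxM; last exact: polymx_const.
  apply: polymxM; first exact: polymx_const.
  by apply: polymx_chart => K g h; apply: polymx_mid_stable.
move=> x [[W [inv dimW rkW]] nZ].
have rk : isotropy_rank form W = l.
  apply/eqP; rewrite eqn_leq rkW andbT leqNgt; apply/negP => lt; apply: nZ.
  by exists W.
have [X1 [X2 [[free1 X1F X12 X2F] [AX1 rAX1 AX2 rAX2]]]] := adapted_data rho_adjoint inv dimW rk.
have [j unitU] := cells X1 free1 X1F.
have [s [t tE]] := cover_by_chart char2 (PF j) unitU
  (fun i => adjoint_gram rho_adjoint _) X1F X12 X2F AX1 rAX1 AX2 rAX2.
exists (j, s), t; rewrite /Phi /= -[LHS]coords_ofK; congr (mxvec _).
by apply/row_matrixP => i; rewrite !rowK tE.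
Qed.

End Upper.

(** * Chains of totally isotropic strata *)

Lemma polyfun_comp (k : fieldType) (I J : finType) (f : (I -> k) -> k) (u : (J -> k) -> I -> k) :
  polyfun f -> (forall i, polyfun (fun t => u t i)) -> polyfun (fun t => f (u t)).
Proof.
move=> [d [p _ fE]] pu.
apply: polyfun_ext (polyfun_meval (phi := fun j t => u t (enum_val j)) p _) => [t|j]; last
    exact: pu.
by rewrite fE.
Qed.

Section ConjShape.
Variables (k : closedFieldType) (l m : nat).
Variables (Y : 'M[k]_(m, l)) (Z a c b : 'M[k]_l) (x : 'M[k]_(l, m)) (C : 'M[k]_m) (y :
    'M[k]_(m, l)).

Let conj c x y C b := unip_mx Y Z *m ut_mx a x c C y b *m unip_inv Y Z.

Ltac conj_compute := rewrite /conj /unip_mx /unip_inv /ut_mx;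
  rewrite !(mulmx_block, mul_block_col, mul_row_block, mul_row_col, mul_col_row,
   mul_mx_row, mul_col_mx, mul1mx, mulmx1, mul0mx, mulmx0, addr0, add0r, add_row_mx,
       add_col_mx, add_block_mx).

(** Conjugation by a lower unitriangular matrix leaves the upper right block
    alone; the three statements that follow iterate this after the upper right
    blocks have been made to vanish. *)
Lemma conj_shape_c : exists M11 M12 M2 M3, conj c x y C b = block_mx M11 (row_mx M12 c) M2 M3.
Proof. by conj_compute; do 4!eexists. Qed.

Lemma conj_shape_xy : exists M11 M2 N1 N3 N4,
  conj 0 x y C b = block_mx M11 (row_mx x 0) M2 (block_mx N1 y N3 N4).
Proof. by conj_compute; do 5!eexists. Qed.

Lemma conj_shape_diag : exists M2 N3, conj 0 0 0 C b = block_mx a 0 M2 (block_mx C 0 N3 b).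
Proof. by conj_compute; rewrite row_mx0; do 2!eexists. Qed.

Lemma conj_shape_unip : conj 0 0 0 0 0 = block_mx a 0 (col_mx (Y *m a) (Z *m a)) 0.
Proof. by conj_compute; rewrite row_mx0 [block_mx 0 0 0 0]block_mxEv !row_mx0 col_mx0. Qed.

End ConjShape.

Section IsotropicMember.
Variables (k : closedFieldType) (l m r : nat).
Local Notation n := (l + (m + l))%N.
Variable form : {symmetric 'cV[k]_n}.
Variable rho : 'M[k]_n -> 'M[k]_n.
Hypothesis (form_nondeg : nondegenerate form) (rho_adjoint : is_adjoint form rho).

Lemma adjoint_of_shape (F h A As B : 'M[k]_n) : F^T = F -> F \in unitmx ->
    h^T *m F *m h = hyp_form k l m -> As^T *m F = F *m A -> A *m h = h *m B ->
  As *m h = h *m (hyp_form k l m *m B^T *m hyp_form k l m).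
Proof.
move=> symF unitF hF adj hB; have unith := hyp_basis_unit hF.
have unithF : h^T *m F \in unitmx by rewrite unitmx_mul unitmx_tr unith unitF.
apply: (can_inj (mulKmx unithF)).
have adj' : F *m As = A^T *m F.
  by have /(congr1 trmx) := adj; rewrite !trmx_mul trmxK symF.
transitivity (B^T *m hyp_form k l m).
  by rewrite -mulmxA [F *m (As *m h)]mulmxA adj' -hF !mulmxA -!trmx_mul hB.
by rewrite !mulmxA hF hyp_form_sq mul1mx.
Qed.

(** The first block of columns of h spans the required isotropic subspace. *)
Lemma Zge_of_shape (h : 'M[k]_n) (A : 'I_r -> 'M[k]_n) a x c C y b :
  h^T *m gram form *m h = hyp_form k l m ->
  (forall i, A i *m h = h *m ut_mx (a i) (x i) (c i) (C i) (y i) (b i)) ->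
  Zge form rho l l A.
Proof.
move=> hF Ah; have unith := hyp_basis_unit hF.
pose X := lsubmx h; pose E1 : 'M[k]_(n, l) := col_mx 1%:M (col_mx 0 0).
have XE : X = h *m E1.
  by rewrite /X -{1}[h]mulmx1 -mulmx_lsub lsubmx1E /E1 col_mx0.
have gramX p (M : 'M_(n, p)) : X^T *m gram form *m (h *m M) = E1^T *m hyp_form k l m *m M.
  by rewrite XE trmx_mul -hF !mulmxA.
have freeX : row_free X^T.
  apply/row_freeP; exists (gram form *m (h *m col_mx 0 (col_mx 0 1%:M))).
  rewrite [X^T *m _]mulmxA gramX hyp_form_gram trmx1 mul1mx !trmx0 !mul0mx !addr0 //.
have XFX : X^T *m gram form *m X = 0.
  by rewrite {2}XE gramX hyp_form_gram !trmx0 !(mulmx0, mul0mx, addr0).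
have [W WX dimW] := vspace_of_mx freeX.
have WW : (W <= orthov form W)%VS.
  apply/subvP => w /WX[y0 ->]; apply/mem_orthovP => v /WX[z ->].
  by rewrite form_mulmx XFX mulmx0 mul0mx mxE.
have stab (B : 'M[k]_n) a' x' c' C' y' b' : B *m h = h *m ut_mx a' x' c' C' y' b' ->
    stable B W.
  move=> Bh w /WX[y0 ->]; apply/WX; exists (a' *m y0).
  rewrite !mulmxA; congr (_ *m _).
  by rewrite /X mulmx_lsub Bh -mulmx_lsub lsubmx_ut_mx -{1}[h]hsubmxK mul_row_col mulmx0 addr0.
exists W; split=> [i||]; last first.
- by rewrite /isotropy_rank (capv_idPl WW) dimW.
- by [].
split; first exact: stab (Ah i).
have := adjoint_of_shape (gram_sym form) (gram_unit form_nondeg) hF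
  (adjoint_gram rho_adjoint (A i)) (Ah i).
rewrite ut_mx_adjoint; exact: stab.
Qed.

Lemma Zeq_of_Zge (A : 'I_r -> 'M[k]_n) : Zge form rho l l A -> Zeq form rho l l A.
Proof.
move=> ZA; split=> // -[W [_ dimW lt_l]].
have := leq_trans lt_l (dimvS (capvSl W (orthov form W))).
by move=> lt_dim; move: (leq_ltn_trans (eq_leq dimW) lt_dim); rewrite ltnn.
Qed.

End IsotropicMember.

Section LowerIsotropic.
Variables (k : closedFieldType) (l m r : nat).
Local Notation n := (l + (m + l))%N.
Variable form : {symmetric 'cV[k]_n}.
Variable rho : 'M[k]_n -> 'M[k]_n.
Hypothesis char2 : 2%N \notin [pchar k].
Hypothesis (form_nondeg : nondegenerate form) (rho_adjoint : is_adjoint form rho).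
Variable i0 : 'I_r.

Definition mid_full (g : void -> k) (h : mxI m m -> k) : 'M[k]_m := \matrix_(i, j) h (i, j).

Lemma polymx_mid_full (K : finType) (g : void -> K) (h : mxI m m -> K) :
  polymx (fun t : K -> k => mid_full (fun x => t (g x)) (fun x => t (h x))).
Proof. exact: (@polymx_coord k K _ _ h). Qed.

Local Notation I := (chartI l m r void (mxI m m)).

(** At the base point L is standard, the matrix of index i0 is the projection
    to L along U + L', and the other matrices vanish. Since this projection
    determines L, the coordinates of L can be recovered from the tuple. *)
Definition base_point (p : I) : k :=
  if p is inr (i, inl (inl (inl (inl (u, v))))) then ((i == i0) && (u == v))%:R else 0.

(** The block c is always visible in the upper right corner of the matrix.
    When it vanishes, x and y become visible, and when these vanish too, so do
    a, C and b. When the tuple has a = 1 at i0 and no other block, the first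
    block column at i0 is (1, Y, Z). *)
Definition coord_level (p : I) : nat :=
  match p with
  | inl _ => 0
  | inr (_, inl (inl (inr _))) => 3
  | inr (_, inl (inl (inl (inr _)))) => 2
  | inr (_, inr (inl _)) => 2
  | inr _ => 1
  end.

Definition based (t : I -> k) : I -> k := fun p => t p + base_point p.

Definition based_chart (t : I -> k) i := chart mid_full (based t) i.

Definition based_tuple (P : 'M[k]_n) t := coords_of (fun i => P *m based_chart t i *m invmx P).

Definition blk1 (u : 'I_l) : 'I_n := lshift (m + l) u.
Definition blk2 (u : 'I_m) : 'I_n := rshift l (lshift l u).
Definition blk3 (u : 'I_l) : 'I_n := rshift l (rshift m u).

(** For a pair of indices the skew part of Z is half the difference of two
    entries. *)
Definition recover_coord (p : I) (M : 'I_r -> 'M[k]_n) : k :=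
  match p with
  | inl (inl (inl (u, v))) => M i0 (blk2 u) (blk1 v)
  | inl (inl (inr p)) => 2%:R^-1 * (M i0 (blk3 (val p).1) (blk1 (val p).2) - M i0 (blk3 (val
      p).2) (blk1 (val p).1))
  | inl (inr g) => match g with end
  | inr (i, inl (inl (inl (inl (u, v))))) => M i (blk1 u) (blk1 v) - ((i == i0) && (u == v))%:R
  | inr (i, inl (inl (inl (inr (u, v))))) => M i (blk1 u) (blk2 v)
  | inr (i, inl (inl (inr (u, v)))) => M i (blk1 u) (blk3 v)
  | inr (i, inl (inr (u, v))) => M i (blk2 u) (blk2 v)
  | inr (i, inr (inl (u, v))) => M i (blk2 u) (blk3 v)
  | inr (i, inr (inr (u, v))) => M i (blk3 u) (blk3 v)
  end.

Lemma recover_coord_poly (P : 'M[k]_n) (p : I) : P \in unitmx ->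
  exists q : {mpoly k[r * (n * n)]}, forall M, ev q (coords_of (fun i => P *m M i *m invmx P))
      = recover_coord p M.
Proof.
move=> unitP.
have entry i u v : exists q : {mpoly k[r * (n * n)]}, forall M,
    ev q (coords_of (fun i => P *m M i *m invmx P)) = M i u v.
  have [q qE] := @entry_poly k n r P (invmx P) i u v; exists q => M.
  by rewrite qE !mulmxA mulVmx // mul1mx mulmxKV.
case: p => [[[[u v]|p]|[]]|[i [[[[[u v]|[u v]]|[u v]]|[u v]]|[[u v]|[u v]]]]] /=;
  try exact: entry.
  have [q qE] := entry i0 (blk3 (val p).1) (blk1 (val p).2).
  have [q' q'E] := entry i0 (blk3 (val p).2) (blk1 (val p).1).
  by exists (2%:R^-1 *: (q - q')) => M; rewrite -qE -q'E /ev mevalZ mevalB.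
have [q qE] := entry i (blk1 u) (blk1 v).
exists (q - (((i == i0) && (u == v))%:R)%:MP) => M.
by rewrite -qE /ev mevalB mevalC.
Qed.

Lemma based_chartE t i : based_chart t i =
  unip_mx (cY t) (cZ t) *m
  ut_mx (ca t i + (i == i0)%:R%:M) (cx t i) (cc t i) (mid_full (cG t) (cH t i)) (cy t i) (cb t
      i) *m
  unip_inv (cY t) (cZ t).
Proof.
have YE : cY (based t) = cY t by apply/matrixP => u v; rewrite !mxE /based addr0.
have SE : cS (based t) = cS t.
  apply/matrixP => u v; rewrite !mxE; congr (_ - _).
    by case: insub => [p|] //=; rewrite /based addr0.
  by case: insub => [p|] //=; rewrite /based addr0.
have ZE : cZ (based t) = cZ t by rewrite /cZ SE YE.
rewrite /based_chart /chart YE ZE.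
have -> : ca (based t) i = ca t i + (i == i0)%:R%:M.
  by apply/matrixP => u v; rewrite !mxE /based /=; case: (i == i0); case: (u == v); rewrite
      ?mulr1n ?mulr0n.
have -> : cx (based t) i = cx t i by apply/matrixP => u v; rewrite !mxE /based addr0.
have -> : cc (based t) i = cc t i by apply/matrixP => u v; rewrite !mxE /based addr0.
have -> : cy (based t) i = cy t i by apply/matrixP => u v; rewrite !mxE /based addr0.
have -> : cb (based t) i = cb t i by apply/matrixP => u v; rewrite !mxE /based addr0.
have -> // : mid_full (cG (based t)) (cH (based t) i) = mid_full (cG t) (cH t i).
by apply/matrixP => u v; rewrite !mxE /cH /based addr0.
Qed.

Lemma recover_coordE t p : (forall q, (coord_level p < coord_level q)%N -> t q = 0) ->
  recover_coord p (based_chart t) = t p.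
Proof.
move=> higher0.
have c0 i : (coord_level p < 3)%N -> cc t i = 0.
  by move=> lp; apply/matrixP => u v; rewrite !mxE higher0.
have x0 i : (coord_level p < 2)%N -> cx t i = 0.
  by move=> lp; apply/matrixP => u v; rewrite !mxE higher0.
have y0 i : (coord_level p < 2)%N -> cy t i = 0.
  by move=> lp; apply/matrixP => u v; rewrite !mxE higher0.
have a0 i : (coord_level p < 1)%N -> ca t i = 0.
  by move=> lp; apply/matrixP => u v; rewrite !mxE higher0.
have C0 i : (coord_level p < 1)%N -> mid_full (cG t) (cH t i) = 0.
  by move=> lp; apply/matrixP => u v; rewrite !mxE /cH higher0.
have b0 i : (coord_level p < 1)%N -> cb t i = 0.
  by move=> lp; apply/matrixP => u v; rewrite !mxE higher0.
have lvl0 : (coord_level p < 1)%N -> based_chart t i0 = block_mx 1%:M 0 (col_mx (cY t) (cZ t)) 0.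
  move=> lp; have lp2 : (coord_level p < 2)%N by apply: leq_trans lp _.
  have lp3 : (coord_level p < 3)%N by apply: leq_trans lp _.
  rewrite based_chartE eqxx c0 // x0 // y0 // a0 // C0 // b0 // add0r conj_shape_unip.
  by rewrite !mulmx1.
case: p => [[[[u v]|p]|[]]|[i [[[[[u v]|[u v]]|[u v]]|[u v]]|[[u v]|[u v]]]]] /=
   in higher0 c0 x0 y0 a0 C0 b0 lvl0 *.
- by rewrite lvl0 // block_mxEdl col_mxEu mxE.
- rewrite lvl0 // !block_mxEdl !col_mxEd.
  have -> : cZ t (val p).1 (val p).2 - cZ t (val p).2 (val p).1 = 2%:R * cS t (val p).1 (val p).2.
    have symYY : ((cY t)^T *m cY t)^T = (cY t)^T *m cY t by rewrite trmx_mul trmxK.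
    have /matrixP/(_ (val p).1 (val p).2) := symYY.
    have /matrixP/(_ (val p).1 (val p).2) := skew_mxT (fun p => t (inl (inl (inr p)))).
    rewrite -/(cS t) /cZ; move: (cS t) (_ *m _) => S T.
    by rewrite !mxE => -> ->; ring.
  rewrite mulKf; last exact: two_neq0.
  exact: (skew_mxE (fun p => t (inl (inl (inr p)))) p).
- rewrite based_chartE c0 // x0 // y0 //.
  have [M2 [N3 ->]] := conj_shape_diag (cY t) (cZ t) (ca t i + (i == i0)%:R%:M) (cb t i)
      (mid_full (cG t) (cH t i)).
  rewrite block_mxEul !mxE; case: (i == i0); case: (u == v); rewrite ?mulr1n ?mulr0n /=; ring.
- rewrite based_chartE c0 //.
  have [M11 [M2 [N1 [N3 [N4 ->]]]]] := conj_shape_xy (cY t) (cZ t) (ca t i + (i == i0)%:R%:M)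
      (cb t i) (cx t i) (mid_full (cG t) (cH t i)) (cy t i).
  by rewrite block_mxEur row_mxEl mxE.
- rewrite based_chartE.
  have [M11 [M12 [M2 [M3 ->]]]] := conj_shape_c (cY t) (cZ t) (ca t i + (i == i0)%:R%:M) (cc t
      i) (cb t i) (cx t i) (mid_full (cG t) (cH t i)) (cy t i).
  by rewrite block_mxEur row_mxEr mxE.
- rewrite based_chartE c0 // x0 // y0 //.
  have [M2 [N3 ->]] := conj_shape_diag (cY t) (cZ t) (ca t i + (i == i0)%:R%:M) (cb t i)
      (mid_full (cG t) (cH t i)).
  by rewrite block_mxEdr block_mxEul mxE.
- rewrite based_chartE c0 //.
  have [M11 [M2 [N1 [N3 [N4 ->]]]]] := conj_shape_xy (cY t) (cZ t) (ca t i + (i == i0)%:R%:M)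
      (cb t i) (cx t i) (mid_full (cG t) (cH t i)) (cy t i).
  by rewrite block_mxEdr block_mxEur mxE.
- rewrite based_chartE c0 // x0 // y0 //.
  have [M2 [N3 ->]] := conj_shape_diag (cY t) (cZ t) (ca t i + (i == i0)%:R%:M) (cb t i)
      (mid_full (cG t) (cH t i)).
  by rewrite block_mxEdr block_mxEdr mxE.
Qed.

Lemma isotropic_chain : has_irreducible_chain (@Zvar k n r form rho l l)
  (m * l + 'C(l, 2) + r * (3 * (l * l) + 2 * (l * m) + m * m))%N.
Proof.
have [P PF] := exists_hyp_basis char2 (gram_sym form) (gram_unit form_nondeg).
have unitP := hyp_basis_unit PF.
have [q qE] : exists q : I -> {mpoly k[r * (n * n)]}, forall p M,
    ev (q p) (coords_of (fun i => P *m M i *m invmx P)) = recover_coord p M.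
  apply: (@fin_all_exists I (fun _ => {mpoly k[r * (n * n)]}) (fun p q => forall M,
    ev q (coords_of (fun i => P *m M i *m invmx P)) = recover_coord p M)) => p.
  exact: recover_coord_poly.
have := @chain_of_chart k _ I (based_tuple P) (fun _ => 1) _ _ _ coord_level q (fun _ _ => 1).
rewrite card_chartI !(card_prod, card_void, card_ord) addn0; apply.
- move=> j; apply: polyfun_coords => i.
  apply: polymxM; last exact: polymx_const.
  apply: polymxM; first exact: polymx_const.
  move=> u v; apply: (polyfun_comp (f := fun t => chart mid_full t i u v)).
    by apply: polymx_chart => K g h; apply: polymx_mid_full.
  by move=> p; apply: polyfunD; [apply: polyfun_var | apply: polyfun_const].
- exact: polyfun_const.
- exact: oner_neq0.
- move=> t _; apply: Zeq_of_Zge.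
  have iso := chart_isotropic_graph char2 t.
  apply: (@Zge_of_shape _ _ _ _ _ _ form_nondeg rho_adjoint (P *m unip_mx (cY t) (cZ t))).
    by rewrite trmx_mul -(unip_mx_form iso) -PF !mulmxA.
  move=> i; rewrite tuple_of_coordsE based_chartE -!mulmxA mulKmx //.
  by rewrite (mulmx1C (unip_mxV iso)) mulmx1.
- by move=> p; apply: polyfun_const.
- by move=> p; apply: oner_neq0.
- by move=> p t /recover_coordE pt; rewrite qE pt mulr1.
Qed.

End LowerIsotropic.

(** * Chains of the stratum of nondegenerate lines *)

Section Hankel.
Variable k : closedFieldType.

Definition mxpow n (A : 'M[k]_n) e : 'M_n := iter e (mulmx A) 1%:M.

Lemma mxpowD n (A : 'M[k]_n) i j : mxpow A (i + j) = mxpow A i *m mxpow A j.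
Proof. by elim: i => [|i IH]; rewrite ?mul1mx // addSn /= IH mulmxA. Qed.

Lemma horner_mx_pow n (C : 'M[k]_n.+1) (q : {poly k}) N : (size q <= N)%N ->
  horner_mx C q = \sum_(j < N) q`_j *: mxpow C j.
Proof.
move=> szq.
have -> : q = \sum_(j < N) q`_j *: 'X^j.
  rewrite -poly_def; apply/polyP => i; rewrite coef_poly; case: ltnP => // Ni.
  by rewrite nth_default // (leq_trans szq).
rewrite raddf_sum /=; apply: eq_bigr => j _.
rewrite -poly_def coef_poly ltn_ord linearZ rmorphXn /= horner_mx_X; congr (_ *: _).
by elim: (nat_of_ord j) => [|i IH]; rewrite ?expr0 // exprS IH.
Qed.

(** The Cayley-Hamilton theorem, in a form that also covers matrices of size
    zero. *)
Lemma char_poly_multiple_pow n (C : 'M[k]_n) (q : {poly k}) N : (size q <= N)%N ->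
  char_poly C %| q -> \sum_(j < N) q`_j *: mxpow C j = 0.
Proof.
case: n C => [|n] C szq; first by move=> _; rewrite [LHS]thinmx0.
by move=> /dvdpP[p qE]; rewrite -horner_mx_pow // qE rmorphM /= Cayley_Hamilton mulr0.
Qed.

(** Its determinant is the discriminant of the characteristic polynomial of S. *)
Definition hankel n (S : 'M[k]_n) : 'M[k]_n := \matrix_(i, j) \tr (mxpow S (i + j)).

Lemma hankel_conj n (S h B : 'M[k]_n) : h \in unitmx -> S *m h = h *m B -> hankel S = hankel B.
Proof.
move=> unith Sh; have SE : S = h *m B *m invmx h by rewrite -Sh mulmxK.
apply/matrixP => i j; rewrite !mxE.
have -> : mxpow S (i + j) = h *m mxpow B (i + j) *m invmx h.
  elim: (i + j)%N => [|e IH] /=; first by rewrite mulmx1 mulmxV.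
  by rewrite IH SE !mulmxA mulmxKV.
by rewrite mxtrace_mulC mulmxA mulVmx // mul1mx.
Qed.

Lemma mxpow_ut l m (a : 'M[k]_l) (x : 'M_(l, m)) c C y b e :
  exists x' c' y', mxpow (ut_mx a x c C y b) e = ut_mx (mxpow a e) x' c' (mxpow C e) y' (mxpow
      b e).
Proof.
elim: e => [|e [x' [c' [y' IH]]]] /=.
  by exists 0, 0, 0; rewrite /ut_mx row_mx0 -!scalar_mx_block.
rewrite IH; eexists _, _, _; rewrite /ut_mx.
rewrite !(mulmx_block, mul_block_col, mul_row_block, mul_row_col, mul_col_row,
  mul_mx_row, mul_col_mx, mul1mx, mulmx1, mul0mx, mulmx0, addr0, add0r, add_row_mx, add_col_mx,
      add_block_mx).
by rewrite !col_mx0 row_mx0 add0r.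
Qed.

Lemma mxtrace_ut l m (a : 'M[k]_l) (x : 'M_(l, m)) c C y b :
  \tr (ut_mx a x c C y b) = \tr a + (\tr C + \tr b).
Proof. by rewrite /ut_mx !mxtrace_block. Qed.

(** The polynomial q = (X - s) char_poly C has degree one less than the size
    of the matrix, and both s and C are roots of it. As the trace of a power
    of the matrix is the trace of that of C plus twice the power of s, the
    coefficients of q give a vector in the kernel. *)
Lemma hankel_singular m (s : 'M[k]_1) (x : 'M_(1, m)) c C y :
  \det (hankel (ut_mx s x c C y s)) = 0.
Proof.
set B := ut_mx _ _ _ _ _ _.
pose q := ('X - (s 0 0)%:P) * char_poly C.
have monq : q \is monic by rewrite monicMl ?monicXsubC ?char_poly_monic.
have szq : size q = (1 + (m + 1))%N.
  by rewrite size_Mmonic ?char_poly_monic ?polyXsubC_eq0 // size_XsubC size_char_poly addn1.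
have szs e : mxpow s e = ((s 0 0) ^+ e)%:M.
  elim: e => [|e IH] /=; first by rewrite expr0.
  by rewrite IH [s in s *m _]mx11_scalar -scalar_mxM exprS.
apply/eqP/det0P; exists (\row_j q`_j).
  apply: contraTneq monq => /rowP/(_ (rshift 1 (rshift m 0))); rewrite !mxE /= addn0 => qm.
  have lc : lead_coef q = q`_(1 + m) by rewrite lead_coefE szq addn1.
  by rewrite monicE lc qm eq_sym oner_eq0.
apply/rowP => i; rewrite !mxE.
have trB e : \tr (mxpow B e) = (s 0 0) ^+ e *+ 2 + \tr (mxpow C e).
  have [x' [c' [y' ->]]] := mxpow_ut s x c C y s e.
  by rewrite mxtrace_ut szs !mxtrace_scalar mulr1n mulr2n; ring.
rewrite (eq_bigr (fun j : 'I_(1 + (m + 1)) => (s 0 0) ^+ i *+ 2 * (q`_j * (s 0 0) ^+ j)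
    + \tr (mxpow C i *m (q`_j *: mxpow C j)))); last first.
  move=> j _; rewrite !mxE trB [(j + i)%N]addnC mxpowD exprD -scalemxAr mxtraceZ; ring.
rewrite big_split /= -mulr_sumr -(raddf_sum (@mxtrace k m)) /= -mulmx_sumr.
rewrite char_poly_multiple_pow ?szq // ?dvdp_mull // mulmx0 mxtrace0 addr0.
by rewrite -(horner_coef_wide _ (eq_leq szq)) /q hornerM hornerXsubC subrr mul0r mulr0.
Qed.

Lemma det_hankel_diag n (d : 'rV[k]_n) : injective (d 0) -> \det (hankel (diag_mx d)) != 0.
Proof.
move=> d_inj.
have powE e : mxpow (diag_mx d) e = diag_mx (\row_j d 0 j ^+ e).
  elim: e => [|e IH] /=; first by apply/matrixP => i j; rewrite !mxE expr0.
  by rewrite IH mulmx_diag; congr diag_mx; apply/rowP => j; rewrite !mxE exprS.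
have -> : hankel (diag_mx d) = Vandermonde n d *m (Vandermonde n d)^T.
  apply/matrixP => i j; rewrite !mxE powE mxtrace_diag; apply: eq_bigr => h _.
  by rewrite !mxE exprD.
rewrite det_mulmx det_tr mulf_neq0 // det_Vandermonde.
  apply/prodf_neq0 => i _; apply/prodf_neq0 => j ij.
  by rewrite subr_eq0 (inj_eq d_inj) -val_eqE; case: ltngtP ij.
apply/prodf_neq0 => i _; apply/prodf_neq0 => j ij.
by rewrite subr_eq0 (inj_eq d_inj) -val_eqE; case: ltngtP ij.
Qed.

(** In positive characteristic the multiples of 1 do not suffice. *)
Lemma exists_distinct n : exists d : 'rV[k]_n, injective (d 0).
Proof.
have [s us ss] : exists2 s : seq k, uniq s & size s = n.
  elim: n => [|n [s us ss]]; first by exists [::].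
  have [x xs] := @poly_nonroot k (\prod_(z <- s) ('X - z%:P)) (monic_neq0 (monic_prod_XsubC _ _
      _)).
  by exists (x :: s); rewrite /= ?ss // us andbT -root_prod_XsubC.
exists (\row_i s`_i) => i j; rewrite !mxE => /eqP.
by rewrite nth_uniq ?ss // => /eqP/val_inj.
Qed.

End Hankel.

Section LowerNondegenerate.
Variables (k : closedFieldType) (m : nat).
Local Notation n := (1 + (m + 1))%N.
Variable form : {symmetric 'cV[k]_n}.
Variable rho : 'M[k]_n -> 'M[k]_n.
Hypothesis char2 : 2%N \notin [pchar k].
Hypothesis (form_nondeg : nondegenerate form) (rho_adjoint : is_adjoint form rho).

Lemma adjoint_orthonormal (P A M : 'M[k]_n) :
  P^T *m gram form *m P = 1%:M -> A *m P = P *m M -> rho A *m P = P *m M^T.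
Proof.
move=> PF AP; have unitP : P \in unitmx by have [] := mulmx1_unit PF.
have unitPF : P^T *m gram form \in unitmx.
  by rewrite unitmx_mul unitmx_tr unitP gram_unit.
apply: (can_inj (mulKmx unitPF)).
have adj : gram form *m rho A = A^T *m gram form.
  by have /(congr1 trmx) := adjoint_gram rho_adjoint A; rewrite !trmx_mul trmxK gram_sym.
rewrite -mulmxA [gram form *m (rho A *m P)]mulmxA adj !mulmxA PF -trmx_mul AP.
by rewrite trmx_mul -!mulmxA [P^T *m _]mulmxA PF mulmx1 mul1mx.
Qed.

(** If an isotropic line and its orthogonal are stable under A, the
    self-adjoint endomorphism A + rho A acts by the same scalar on the line
    and on the quotient by its orthogonal, so it has a repeated eigenvalue. *)
Lemma hankel_Zge11 (P A M : 'M[k]_n) (r : nat) (As : 'I_r -> 'M[k]_n) i :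
    P^T *m gram form *m P = 1%:M -> As i = A -> A *m P = P *m M ->
    Zge form rho 1 1 As -> \det (hankel (M + M^T)) = 0.
Proof.
move=> PF AiE AP [W [inv dimW rkW]].
have unitP : P \in unitmx by have [] := mulmx1_unit PF.
have rk1 : isotropy_rank form W = 1%N.
  apply/eqP; rewrite eqn_leq rkW andbT.
  exact: leq_trans (dimvS (capvSl W (orthov form W))) (eq_leq dimW).
have [X1 [X2 [[free1 X1F _ _] [AX1 rAX1 _ _]]]] := adapted_data (l := 1) (e := 0) rho_adjoint
    inv dimW rk1.
have [h hF hX1] := witt_isotropic char2 (gram_sym form) (gram_unit form_nondeg) free1 X1F.
have [[R AR] [R' rAR]] := (AX1 i, rAX1 i); rewrite AiE -hX1 in AR rAR.
have [x [c [C [y [Ah rAh]]]]] := adapted_shape hF (adjoint_gram rho_adjoint A) AR rAR.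
have tr1 (S : 'M[k]_1) : S^T = S by rewrite [S]mx11_scalar tr_scalar_mx.
have rAP := adjoint_orthonormal PF AP.
have unith := hyp_basis_unit hF.
pose g := invmx P *m h.
have unitg : g \in unitmx by rewrite unitmx_mul unitmx_inv unitP unith.
have Mg (B N S : 'M[k]_n) : B *m P = P *m N -> B *m h = h *m S -> N *m g = g *m S.
  move=> BP Bh; apply: (can_inj (mulKmx unitP)).
  by rewrite /g !mulmxA -BP !mulmxK // mulmxV // mul1mx -Bh.
rewrite (hankel_conj unitg (B := ut_mx (R + R') (x + y^T) (c + c^T) (C + C^T) (y + x^T) (R +
    R'))).
  exact: hankel_singular.
rewrite mulmxDl (Mg _ _ _ AP Ah) (Mg _ _ _ rAP rAh) -mulmxDr; congr (_ *m _).
by rewrite /ut_mx !add_block_mx add_row_mx !addr0 !tr1 [R' + R]addrC.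
Qed.

Definition eigI : finType := (unit + 'I_(m + 1) + mxI (m + 1) (m + 1))%type.

Lemma card_eigI : #|eigI| = (1 + (m + 1) + (m + 1) * (m + 1))%N.
Proof. by rewrite !(card_sum, card_prod, card_unit, card_ord). Qed.

Variable d : 'rV[k]_n.
Hypothesis d_inj : injective (d 0).
Implicit Type t : eigI -> k.

Definition elam t : k := t (inl (inl tt)) + d 0 (lshift (m + 1) 0).
Definition evec t : 'cV[k]_(m + 1) := \col_j t (inl (inr j)).
Definition ecomp t : 'M[k]_(m + 1) := \matrix_(i, j) t (inr (i, j)) + diag_mx (rsubmx d).
Definition emid t := (elam t)%:M - ecomp t.
(** The matrix with lower right block C for which (1, u) is an eigenvector,
    with eigenvalue lam, of both the matrix and its transpose; these
    conditions determine its other blocks. At t = 0 it is the diagonal matrix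
    of d. *)
Definition eig_mx t : 'M[k]_n :=
  block_mx ((elam t)%:M - (evec t)^T *m emid t *m evec t) ((evec t)^T *m emid t)
           (emid t *m evec t) (ecomp t).

Lemma polymx_eig_mx : polymx eig_mx.
Proof.
have pl : polyfun elam by apply: polyfunD; [apply: polyfun_var | apply: polyfun_const].
have plM q : polymx (fun t => (elam t)%:M : 'M_q).
  move=> i j; apply: polyfun_ext (_ : polyfun (fun t => elam t * (i == j)%:R)) => [t|].
    by rewrite mxE; case: (i == j); rewrite ?mulr1 ?mulr1n ?mulr0 ?mulr0n.
  by apply: polyfunM => //; apply: polyfun_const.
have pv : polymx evec by move=> i j; apply: polyfun_ext (polyfun_var k (inl (inr i))) => t;
    rewrite mxE.
have pC : polymx ecomp.
  by apply: polymxD; [apply: (@polymx_coord k eigI _ _ inr) | apply: polymx_const].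
have pL : polymx emid by apply: polymxD => //; apply: polymxN.
have pvT := polymx_tr pv; have pvL := polymxM pvT pL.
apply: polymx_block => //; last exact: polymxM.
by apply: polymxD => //; apply: polymxN; apply: polymxM.
Qed.

Lemma eig_mx_eigenvector t (b : bool) :
  (if b then (eig_mx t)^T else eig_mx t) *m col_mx 1%:M (evec t) = col_mx 1%:M (evec t) *m
      (elam t)%:M.
Proof.
have aux (C : 'M[k]_(m + 1)) : let L := (elam t)%:M - C in
    block_mx ((elam t)%:M - (evec t)^T *m L *m evec t) ((evec t)^T *m L) (L *m evec t) C
      *m col_mx 1%:M (evec t) = col_mx 1%:M (evec t) *m (elam t)%:M.
  move=> L; rewrite mul_block_col mul_col_mx !mulmx1 mul1mx subrK; congr col_mx.
  by rewrite /L mulmxBl subrK mul_scalar_mx mul_mx_scalar.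
case: b; last exact: aux.
rewrite /eig_mx tr_block_mx -[RHS](aux (ecomp t)^T) /emid /=; congr (_ *m _).
have LT : (elam t)%:M - (ecomp t)^T = ((elam t)%:M - ecomp t)^T by rewrite trmxD trmxN
    tr_scalar_mx.
rewrite LT; move: ((elam t)%:M - ecomp t) => L; congr block_mx.
- by rewrite trmxD trmxN tr_scalar_mx !trmx_mul !trmxK mulmxA.
- by rewrite trmx_mul.
by rewrite trmx_mul trmxK.
Qed.

Definition eig_tuple (P : 'M[k]_n) t := coords_of (fun _ : 'I_1 => P *m eig_mx t *m invmx P).

(** C is an entry block of the matrix. Once C is diagonal, the first column
    shows (lam - C) u, which determines u when lam is not an eigenvalue of C;
    once u = 0, lam is the corner entry. *)
Definition eig_level (p : eigI) : nat := match p with inl (inl _) => 0 | inl (inr _) => 1 | inr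
    _ => 2 end.

Definition recover_eig (p : eigI) (M : 'M[k]_n) : k :=
  match p with
  | inl (inl _) => M (lshift (m + 1) 0) (lshift (m + 1) 0) - d 0 (lshift (m + 1) 0)
  | inl (inr j) => M (rshift 1 j) (lshift (m + 1) 0)
  | inr (i, j) => M (rshift 1 i) (rshift 1 j) - diag_mx (rsubmx d) i j
  end.

Definition eig_unit (p : eigI) t : k :=
  if p is inl (inr j) then elam t - d 0 (rshift 1 j) else 1.

Lemma recover_eigE t p : (forall q, (eig_level p < eig_level q)%N -> t q = 0) ->
  recover_eig p (eig_mx t) = t p * eig_unit p t.
Proof.
case: p => [[[]|j]|[i j]] /= t0.
- have v0 : evec t = 0 by apply/matrixP => i j; rewrite !mxE t0.
  rewrite block_mxEul v0 mulmx0 subr0 !mxE mulr1n mulr1 addrK //.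
- have C0 : ecomp t = diag_mx (rsubmx d).
    by apply/matrixP => a b; rewrite !mxE t0 // add0r.
  rewrite block_mxEdl /emid C0 mulmxBl mul_scalar_mx mul_diag_mx !mxE; ring.
- by rewrite block_mxEdr /ecomp mxE addrK mxE mulr1.
Qed.

Lemma nondegenerate_chain :
  has_irreducible_chain (@Zvar k n 1 form rho 0 1) (1 + (m + 1) + (m + 1) * (m + 1)).
Proof.
have [P PF] := orthonormal_basis char2 (gram_sym form) (gram_unit form_nondeg).
have unitP : P \in unitmx by have [] := mulmx1_unit PF.
have unitF := gram_unit form_nondeg.
have [q qE] : exists q : eigI -> {mpoly k[1 * (n * n)]}, forall p M,
    ev (q p) (coords_of (fun _ : 'I_1 => P *m M *m invmx P)) = recover_eig p M.
  apply: (@fin_all_exists eigI (fun _ => {mpoly k[1 * (n * n)]}) (fun p q => forall M,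
    ev q (coords_of (fun _ : 'I_1 => P *m M *m invmx P)) = recover_eig p M)) => p.
  have entry u v : exists q : {mpoly k[1 * (n * n)]}, forall M,
      ev q (coords_of (fun _ : 'I_1 => P *m M *m invmx P)) = M u v.
    have [q qE] := @entry_poly k n 1 P (invmx P) 0 u v; exists q => M.
    by rewrite qE !mulmxA mulVmx // mul1mx mulmxKV.
  case: p => [[[]|j]|[i j]] /=; last 1 first.
  - have [q qE] := entry (rshift 1 i) (rshift 1 j).
    by exists (q - (diag_mx (rsubmx d) i j)%:MP) => M; rewrite -qE /ev mevalB mevalC.
  - have [q qE] := entry (lshift (m + 1) 0) (lshift (m + 1) 0).
    by exists (q - (d 0 (lshift (m + 1) 0))%:MP) => M; rewrite -qE /ev mevalB mevalC.
  - exact: entry.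
pose h t := \det (hankel (eig_mx t + (eig_mx t)^T)).
rewrite -card_eigI; apply: (@chain_of_chart k _ eigI (eig_tuple P) h _ _ _ eig_level q eig_unit).
- move=> j; apply: polyfun_coords => i.
  apply: polymxM; last exact: polymx_const.
  apply: polymxM; first exact: polymx_const.
  exact: polymx_eig_mx.
- apply: polymx_det => i j.
  apply: polyfun_ext (_ : polyfun (fun t => \tr (mxpow (eig_mx t + (eig_mx t)^T) (i + j)))) =>
      [t|].
    by rewrite mxE.
  apply: polymx_trace; elim: (i + j)%N => [|e IH]; first exact: polymx_const.
  apply: polymxM IH; apply: polymxD; first exact: polymx_eig_mx.
  exact/polymx_tr/polymx_eig_mx.
- rewrite /h; have -> : eig_mx (fun=> 0) = diag_mx d.
    have v0 : evec (fun=> 0) = 0 by apply/matrixP => i j; rewrite !mxE.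
    rewrite /eig_mx v0 !mulmx0 trmx0 mul0mx subr0 /ecomp /elam add0r.
    rewrite [X in block_mx _ _ _ (X + _)](_ : _ = 0) ?add0r; last by apply/matrixP => i j;
        rewrite !mxE.
    rewrite -[d in RHS]hsubmxK diag_mx_row; congr block_mx.
    by apply/matrixP => i j; rewrite !ord1 !mxE.
  have -> : diag_mx d + (diag_mx d)^T = diag_mx (2%:R *: d).
    by rewrite tr_diag_mx linearZ /= scaler_nat mulr2n.
  apply: det_hankel_diag => i j; rewrite !mxE => /(mulfI (two_neq0 char2)); exact: d_inj.
- move=> t ht; split; last first.
    move=> Z11; case/negP: ht; apply/eqP.
    apply: (@hankel_Zge11 P _ (eig_mx t) 1 _ 0 PF erefl _ Z11).
    by rewrite tuple_of_coordsE mulmxKV.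
  pose X := P *m col_mx 1%:M (evec t).
  have freeX : row_free X^T.
    apply/row_freeP; exists (gram form *m P *m col_mx 1%:M 0).
    rewrite trmx_mul -!mulmxA [P^T *m _]mulmxA [P^T *m gram form *m _]mulmxA PF mul1mx.
    by rewrite tr_col_mx mul_row_col mulmx0 addr0 trmx1 mulmx1.
  have [W WX dimW] := vspace_of_mx freeX.
  exists W; split=> // i; rewrite tuple_of_coordsE.
  have stab (B : 'M[k]_n) b : B *m P = P *m (if b then (eig_mx t)^T else eig_mx t) -> stable B W.
    move=> BP w /WX[y ->]; apply/WX; exists ((elam t)%:M *m y).
    rewrite /X !mulmxA BP; congr (_ *m _).
    by rewrite -!mulmxA eig_mx_eigenvector.
  split; first by apply: (stab _ false); rewrite mulmxKV.
  by apply: (stab _ true); apply: adjoint_orthonormal PF _; rewrite mulmxKV.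
- case=> [[[]|j]|[i j]] /=; try exact: polyfun_const.
  apply: polyfunD; last exact: polyfun_const.
  by apply: polyfunD; [apply: polyfun_var | apply: polyfun_const].
- case=> [[[]|j]|[i j]] /=; try exact: oner_neq0.
  by rewrite /elam add0r subr_eq0 (inj_eq d_inj) -val_eqE.
- by move=> p t t0; rewrite qE recover_eigE.
Qed.

End LowerNondegenerate.

(** * Comparison of the strata *)

Lemma double_bin2 l : ('C(l, 2) * 2 + l = l * l)%N.
Proof.
have := bin_ffact l 2; rewrite /= mulnC => ->.
by case: l => // l; rewrite ffactnS ffactn1 /=; lia.
Qed.

Lemma square_sub n : (n ^ 2 - n + n = n * n)%N.
Proof. by rewrite subnK ?mulnn // -mulnn; case: n => // n; rewrite leq_pmulr. Qed.

(** The difference n^2 - n + 1 - stratum_dim 1 l e f equals (l - 1)(l - 2) / 2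
    + (l - 1)(e + f) + e f. For l = 0 this is (e - 1)(f - 1), for l = 1 it is
    e f, and for l >= 2 it vanishes only if l = 2 and n = 4. *)
Lemma stratum_dim1 n l e f : n = (2 * l + e + f)%N -> (e <= f)%N -> (0 < l + e)%N -> n <> 4%N ->
  (stratum_dim 1 l e f + (l + e != 1) <= n ^ 2 - n + 1)%N.
Proof.
rewrite /stratum_dim => En ef le_gt0 n4.
have C2 := double_bin2 l; move: ('C(l, 2)) C2 => C C2.
have := square_sub n; move: (n ^ 2 - n)%N => D DE.
rewrite En in DE.
case: l => [|[|l]] in En C2 le_gt0 n4 DE *.
- case: e => [|[|e]] in En C2 le_gt0 DE ef *; nia.
- case: e => [|e] in En C2 le_gt0 DE ef *; nia.
- case: l => [|l] in En C2 le_gt0 n4 DE *; last nia.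
  have : (0 < e + f)%N by lia.
  nia.
Qed.

(** The growth of stratum_dim with r. Here the difference is (l - 1)(l - 3) +
    2 (l - 1)(e + f) + 2 e f, which is negative only if l = 2 and n = 4. *)
Lemma stratum_dim_step n l e f : n = (2 * l + e + f)%N -> (e <= f)%N -> (0 < l + e)%N -> n <>
    4%N ->
  (3 * (l * l) + 2 * (l * (e + f)) + (e * e + f * f) + (l == 0) <= n ^ 2 - 2 * n + 3)%N.
Proof.
move=> En ef le_gt0 n4.
have [n2 DE] : (2 <= n)%N /\ (n ^ 2 - 2 * n + 2 * n = n * n)%N.
  have n2 : (2 <= n)%N by lia.
  by split=> //; rewrite subnK ?mulnn // -mulnn leq_mul2r n2 orbT.
move: (n ^ 2 - 2 * n)%N DE => D; rewrite En => DE.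
case: l => [|[|[|l]]] in En le_gt0 n4 DE *.
- case: e => [|e] in En le_gt0 DE ef *; first by [].
  case: f => [|f] in En DE ef *; first by [].
  nia.
- nia.
- have : (0 < e + f)%N by lia.
  nia.
- nia.
Qed.

Lemma stratum_dim_succ r l e f : (stratum_dim r.+1 l e f = stratum_dim 1 l e f +
  r * (3 * (l * l) + 2 * (l * (e + f)) + (e * e + f * f)))%N.
Proof. by rewrite /stratum_dim mulSn mul1n addnA. Qed.

Lemma stratum_dim_ge2 n r l e f : (2 <= r)%N -> n = (2 * l + e + f)%N -> (e <= f)%N -> (0 < l +
    e)%N -> n <> 4%N ->
  (stratum_dim r l e f + ((l != 1) || (e != 0)) <= n - 2 + r * (n ^ 2 - 2 * n + 3))%N.
Proof.
case: r => // r r1 En ef le_gt0 n4; rewrite stratum_dim_succ.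
have H1 := stratum_dim1 En ef le_gt0 n4.
have H2 := stratum_dim_step En ef le_gt0 n4.
have n2 : (2 <= n)%N by lia.
have : (n ^ 2 - n + 1 = n - 2 + (n ^ 2 - 2 * n + 3))%N.
  have : (2 * n <= n ^ 2)%N by rewrite -mulnn leq_mul2r n2 orbT.
  by move: (n ^ 2)%N => N; lia.
move: (n ^ 2 - n + 1)%N (n ^ 2 - 2 * n + 3)%N H1 H2 => M1 G H1 H2 ME.
move: (3 * _ + _ + _)%N H2 => g H2.
move: (stratum_dim _ _ _ _) H1 => s H1.
have : (r * g + r * (l == 0) <= r * G)%N by rewrite -mulnDr leq_mul2l H2 orbT.
rewrite mulSn addnA -ME => Hr.
case: l => [|[|l]] in En le_gt0 H1 H2 Hr *; case: e => [|[|e]] in En ef le_gt0 H1 Hr *;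
  rewrite /= ?addn0 ?add0n ?muln0 ?muln1 in H1 Hr *; lia.
Qed.

(** A bound on the lengths of chains that is attained, together with the top
    of a longest chain being a component, gives the dimension. *)
Lemma max_dim_of_bounds (k : closedFieldType) n N (Z : nat -> nat -> 'rV[k]_N -> Prop)
    (S : seq (nat * nat)) M (b : nat -> nat -> nat) :
  (forall l d m, (1 <= d)%N -> (2 * d <= n)%N -> (l <= d)%N ->
     has_irreducible_chain (Z l d) m -> (m <= b l d)%N) ->
  (forall l d, (1 <= d)%N -> (2 * d <= n)%N -> (l <= d)%N ->
     (b l d + ((l, d) \notin S) <= M)%N) ->
  (forall l d, (l, d) \in S -> has_irreducible_chain (Z l d) M) ->
  max_dim_exactly_at n Z S M.
Proof.
move=> upper bM lower l d d1 dn ld.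
have bound m := upper l d m d1 dn ld; have {}bM := bM l d d1 dn ld.
have nchain : ~ has_irreducible_chain (Z l d) M.+1.
  by move=> /bound; lia.
have ndim : ~ dim_ge (Z l d) M.+1 by move/dim_ge_chain.
split=> //; split=> [[/dim_ge_chain/bound Mb _]|inS].
  by apply: contraT => nS; rewrite nS in bM; lia.
by split=> //; apply: chain_dim_ge => //; apply: lower.
Qed.

Lemma isotropic_chain_dim (k : closedFieldType) l m n r (form : {symmetric 'cV[k]_n})
    (rho : 'M[k]_n -> 'M[k]_n) : n = (l + (m + l))%N -> 2%N \notin [pchar k] ->
    nondegenerate form -> is_adjoint form rho -> (0 < r)%N ->
  has_irreducible_chain (@Zvar k n r form rho l l) (stratum_dim r l 0 m).
Proof.
move=> En char2 nondeg adj r0; subst n; case: r r0 => // r _.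
have := isotropic_chain char2 nondeg adj (ord0 : 'I_r.+1).
by congr has_irreducible_chain; rewrite /stratum_dim; lia.
Qed.

Lemma nondegenerate_chain_dim (k : closedFieldType) m n r (form : {symmetric 'cV[k]_n})
    (rho : 'M[k]_n -> 'M[k]_n) : n = (1 + (m + 1))%N -> 2%N \notin [pchar k] ->
    nondegenerate form -> is_adjoint form rho -> r = 1%N ->
  has_irreducible_chain (@Zvar k n r form rho 0 1) (1 + (m + 1) + (m + 1) * (m + 1)).
Proof.
move=> En char2 nondeg adj r1; subst n r.
have [d d_inj] := exists_distinct k (1 + (m + 1)).
exact: nondegenerate_chain char2 nondeg adj d d_inj.
Qed.

Theorem proposition4p10 (k : closedFieldType) (n r : nat)
    (form : {symmetric 'cV[k]_n}) (rho : 'M[k]_n -> 'M[k]_n)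
    (char_k : 2%N \notin [pchar k])
    (form_nondeg : nondegenerate form)
    (rho_adjoint : is_adjoint form rho)
    (n_ge2 : (2 <= n)%N) (r_ge1 : (1 <= r)%N) :
  let Z := @Zvar k n r form rho in
  [/\ n = 4%N -> r = 1%N ->
        max_dim_exactly_at n Z [:: (0, 1); (1, 1); (2, 2)]%N 13,
      n = 4%N -> (2 <= r)%N ->
        max_dim_exactly_at n Z [:: (2, 2)]%N (12 * r + 1),
      n <> 4%N -> r = 1%N ->
        max_dim_exactly_at n Z [:: (0, 1); (1, 1)]%N (n ^ 2 - n + 1) &
      n <> 4%N -> (2 <= r)%N ->
        max_dim_exactly_at n Z [:: (1, 1)]%N
          (n - 2 + r * (n ^ 2 - 2 * n + 3))].
Proof.
move=> Z.
pose b l d := stratum_dim r l (d - l) (n - d - l).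
have upper l d m : (1 <= d)%N -> (2 * d <= n)%N -> (l <= d)%N ->
    has_irreducible_chain (Z l d) m -> (m <= b l d)%N.
  move=> d1 dn ld; rewrite -{1}(subnKC ld); apply: Zvar_chain_le => //; lia.
have isotropic l M : (2 * l <= n)%N -> M = stratum_dim r l 0 (n - l - l) ->
    has_irreducible_chain (Z l l) M.
  move=> ln ->; have En : n = (l + ((n - l - l) + l))%N by lia.
  exact: isotropic_chain_dim En char_k form_nondeg rho_adjoint r_ge1.
have line M : r = 1%N -> M = (n ^ 2 - n + 1)%N -> has_irreducible_chain (Z 0 1) M.
  move=> r1 ->; have En : n = (1 + ((n - 2) + 1))%N by lia.
  have := @nondegenerate_chain_dim k (n - 2) n r form rho En char_k form_nondeg rho_adjoint r1.
  congr has_irreducible_chain; have := square_sub n; move: (n ^ 2 - n)%N => D DE.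
  have : (n - 2 + 2 = n)%N by lia.
  move: (n - 2)%N => m mE; rewrite -mE in DE; nia.
split.
- move=> n4 r1; apply: (max_dim_of_bounds upper) => [l d d1 dn ld|l d].
    rewrite /b /stratum_dim n4 r1 in dn *.
    have [d2|d2] : d = 1%N \/ d = 2%N by lia.
      by rewrite d2 in ld *; case: l ld => [|[|l]] //.
    by rewrite d2 in ld *; case: l ld => [|[|[|l]]] //.
  rewrite !inE => /or3P[] /eqP[-> ->].
  + by apply: line; rewrite ?n4.
  + by apply: isotropic; rewrite ?n4 ?r1.
  + by apply: isotropic; rewrite ?n4 ?r1.
- move=> n4 r2; apply: (max_dim_of_bounds upper) => [l d d1 dn ld|l d].
    rewrite /b /stratum_dim n4 in dn *.
    have [d2|d2] : d = 1%N \/ d = 2%N by lia.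
      by rewrite d2 in ld *; case: l ld => [|[|l]] // _; rewrite !inE /= ?binn ?bin_small //; lia.
    by rewrite d2 in ld *; case: l ld => [|[|[|l]]] // _; rewrite !inE /= ?binn ?bin_small //;
        lia.
  rewrite !inE => /eqP[-> ->]; apply: isotropic; first by rewrite n4.
  by rewrite n4 /stratum_dim /= binn; lia.
- move=> n4 r1; apply: (max_dim_of_bounds upper) => [l d d1 dn ld|l d].
    have := @stratum_dim1 n l (d - l) (n - d - l); rewrite /b r1.
    move=> /(_ _ _ _ n4) H; apply: leq_trans (H _ _ _); try lia.
    rewrite leq_add2l !inE !xpair_eqE; lia.
  rewrite !inE => /orP[] /eqP[-> ->]; first exact: line.
  apply: isotropic => //; rewrite /stratum_dim r1 bin_small //.
  have := square_sub n; move: (n ^ 2 - n)%N => D DE.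
  have : (n - 1 - 1 + 2 = n)%N by lia.
  by move: (n - 1 - 1)%N => m mE; rewrite -mE in DE; nia.
move=> n4 r2; apply: (max_dim_of_bounds upper) => [l d d1 dn ld|l d].
  have := @stratum_dim_ge2 n r l (d - l) (n - d - l) r2; rewrite /b.
  move=> /(_ _ _ _ n4) H; apply: leq_trans (H _ _ _); try lia.
  rewrite leq_add2l !inE !xpair_eqE; lia.
rewrite !inE => /eqP[-> ->]; apply: isotropic => //.
rewrite /stratum_dim /=.
have n2 : (n - 1 - 1 + 2 = n)%N by lia.
have -> : (n ^ 2 - 2 * n + 3 = 3 + 2 * (n - 1 - 1) + (n - 1 - 1) * (n - 1 - 1))%N.
  by move: (n - 1 - 1)%N n2 => m <-; nia.
by rewrite !muln1 !mul0n !mul1n bin_small //; lia.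
Qed.
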